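(* For every $\epsilon>0$ there exists a $(4+\epsilon)$-approximation algorithm for the Tree Search Problem running in time $O(n^4/\epsilon^2)$, where $n$ is the number of vertices of the input tree. That is, there is an algorithm which, given a tree $T$ with $n$ vertices, a query cost function $c:V(T)\to\mathbb{N}$ and a weight function $w:V(T)\to\mathbb{N}$, outputs in time $O(n^4/\epsilon^2)$ a decision tree $D$ for $T$ with $c_T(D)\le (4+\epsilon)\cdot \texttt{OPT}(T)$, where $\texttt{OPT}(T)$ is the minimum of $c_T(D')$ over all decision trees $D'$ for $T$.
   Context: Graphs are simple and connected. For a connected graph $G$ and $v\in V(G)$, $G-v$ denotes the set of connected components of the graph obtained by deleting $v$. A decision tree for a connected graph $G$ is a rooted tree $D$ with $V(D)=V(G)$ defined recursively: its root $r$ is a vertex of $G$, and for each connected component $H$ of $G-r$ there is exactly one child of $r$, which is the root of a decision tree for $H$ (these subtrees being all of $D-r$). (Interpretation: vertex $r$ is queried; if the hidden target $x$ equals $r$ the search ends, otherwise the component of $G-r$ containing $x$ is revealed and the search continues in the corresponding subtree.) For a target $x\in V(G)$, $Q_G(D,x)$ is the sequence of vertices on the path in $D$ from the root to $x$. Given $c,w:V(G)\to\mathbb{N}$, the cost of $D$ is $c_G(D)=\sum_{x\in V(G)} w(x)\sum_{q\in Q_G(D,x)} c(q)$. The Graph Search Problem asks, given $(G,c,w)$, for a decision tree minimizing $c_G(D)$; the Tree Search Problem is its restriction to inputs where $G$ is a tree. An $\rho$-approximation algorithm outputs, on every instance, a decision tree of cost at most $\rho$ times the optimum. *)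

(* Defs.v *)
From HB Require Import structures.
From mathcomp Require Import all_boot all_order all_algebra.
From mathcomp Require Import reals.

Set Implicit Arguments.
Unset Strict Implicit.
Unset Printing Implicit Defensive.

Section Graphs.
Variables (V : finType) (e : rel V).

Definition simple_connected : Prop :=
  [/\ symmetric e, irreflexive e, 0 < #|V| & forall x y, connect e x y].

(* In a simple graph an edge traversed back and forth is a [ucycle] of length
   2; hence only the lengths above 2 are excluded. *)
Definition is_tree : Prop :=
  simple_connected /\ forall s : seq V, 2 < size s -> ~ ucycle e s.

Definition induced (S : {set V}) : rel V :=
  [rel x y | [&& x \in S, y \in S & e x y]].

Definition components (S : {set V}) : {set {set V}} :=
  equivalence_partition (connect (induced S)) S.

(* A rooted tree on the vertex set V, given by its parent function; the root is
   sent to None. *)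
Definition rooted_tree := {ffun V -> option V}.

(* The part of D lying on S is a decision tree, with root r, for the connected
   subgraph induced by S.  Since the components of S :\ r cover S :\ r and every
   vertex has a single parent, the children of r are exactly the roots s given
   by the clause, one for each component. *)
Inductive decision_tree_on (D : rooted_tree) : {set V} -> V -> Prop :=
  DecisionTreeOn (S : {set V}) (r : V) of r \in S &
      (forall H : {set V}, H \in components (S :\ r) ->
         exists2 s, D s = Some r & decision_tree_on D H s) :
    decision_tree_on D S r.

Definition decision_tree (D : rooted_tree) : Prop :=
  exists2 r, D r = None & decision_tree_on D [set: V] r.

(* The path to x from its ancestor k - 1 levels above, or from the root if that
   comes first. *)
Fixpoint path_down (D : rooted_tree) (k : nat) (x : V) : seq V :=
  if k is k'.+1
  then rcons (if D x is Some y then path_down D k' y else [::]) x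
  else [::].

(* A root-to-vertex path has at most #|V| vertices, so nothing is truncated. *)
Definition queries (D : rooted_tree) (x : V) : seq V := path_down D #|V| x.

Variables c w : V -> nat.

Definition cost (D : rooted_tree) : nat :=
  \sum_x w x * \sum_(q <- queries D x) c q.

Definition is_OPT (m : nat) : Prop :=
  (exists2 D, decision_tree D & cost D = m) /\
  (forall D, decision_tree D -> m <= cost D).

End Graphs.

(* A word RAM with structured control.  The memory consists of arrays of
   natural numbers, a program addressing finitely many of them by fixed names;
   a scalar register is a cell with a constant index.  Every node of an
   expression, every write and every test takes one time unit. *)

Inductive binop := Add | Sub | Mul | Div | Leq.

Inductive expr :=
| Const of nat
| Read of nat & expr
| Op of binop & expr & expr.

Inductive cmd :=
| Skip
| Write of nat & expr & expr
| Seq of cmd & cmd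
| If of expr & cmd & cmd
| While of expr & cmd.

Definition store := nat -> nat -> nat.

Definition update (s : store) (a i v : nat) : store :=
  fun b j => if (b == a) && (j == i) then v else s b j.

(* Truncated subtraction; x %/ 0 = 0. *)
Definition binop_sem (o : binop) (x y : nat) : nat :=
  match o with
  | Add => x + y
  | Sub => x - y
  | Mul => x * y
  | Div => x %/ y
  | Leq => x <= y
  end.

Section Semantics.
(* The largest number that fits in a machine word: evaluation is stuck as soon
   as a larger one shows up, so unit-cost arithmetic cannot be abused by
   computing with huge numbers.  Indices are words as well. *)
Variable B : nat.

Definition word (v : nat) : option nat := if v <= B then Some v else None.

Fixpoint eval (s : store) (x : expr) : option nat :=
  match x with
  | Const v => word v
  | Read a y => obind (fun i => word (s a i)) (eval s y)
  | Op o y z =>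
      obind (fun u => obind (fun v => word (binop_sem o u v)) (eval s z))
            (eval s y)
  end.

Fixpoint expr_time (x : expr) : nat :=
  match x with
  | Const _ => 1
  | Read _ y => (expr_time y).+1
  | Op _ y z => (expr_time y + expr_time z).+1
  end.

(* exec p s t s': started in the store s, the program p halts after t time
   units in the store s'. *)
Inductive exec : cmd -> store -> nat -> store -> Prop :=
| ExecSkip s : exec Skip s 1 s
| ExecWrite s a x y i v :
    eval s x = Some i -> eval s y = Some v ->
    exec (Write a x y) s (expr_time x + expr_time y).+1 (update s a i v)
| ExecSeq p q s s1 s2 t1 t2 :
    exec p s t1 s1 -> exec q s1 t2 s2 -> exec (Seq p q) s (t1 + t2) s2
| ExecIf x p q s s1 b t :
    eval s x = Some b -> exec (if b != 0 then p else q) s t s1 ->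
    exec (If x p q) s ((expr_time x).+1 + t) s1
| ExecWhileEnd x p s :
    eval s x = Some 0 -> exec (While x p) s (expr_time x).+1 s
| ExecWhileLoop x p s s1 s2 b t1 t2 :
    eval s x = Some b.+1 -> exec p s t1 s1 -> exec (While x p) s1 t2 s2 ->
    exec (While x p) s ((expr_time x).+1 + t1 + t2) s2.

End Semantics.

Section InputOutput.
Variable n : nat.

Definition array_of (f : 'I_n -> nat) (i : nat) : nat :=
  if insub i is Some v then f v else 0.

(* Cell 0 of array 0 holds n, array 1 the adjacency matrix in row-major order,
   array 2 the query costs and array 3 the weights; all else is 0. *)
Definition input (e : rel 'I_n) (c w : 'I_n -> nat) : store :=
  fun a i =>
    match a with
    | 0 => if i == 0 then n else 0
    | 1 => array_of (fun u => array_of (fun v => e u v) (i %% n)) (i %/ n)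
    | 2 => array_of c i
    | 3 => array_of w i
    | _ => 0
    end.

(* Array 4 lists the parents: 0 stands for None and u + 1 for Some u. *)
Definition outputs (s : store) (D : rooted_tree 'I_n) : Prop :=
  forall v : 'I_n, s 4 v = if D v is Some u then u.+1 else 0.

End InputOutput.

Section WordSize.
Import GRing.Theory Num.Theory.
Local Open Scope ring_scope.

(* Words have at least k log2 (n + M + 1/eps + 2) bits, where M is the largest
   of the numbers c v and w v. *)
Definition word_bound (R : realType) (k n : nat) (c w : 'I_n -> nat)
    (eps : R) (B : nat) : Prop :=
  ((n + \max_(v < n) maxn (c v) (w v))%N%:R + eps^-1 + 2) ^+ k <= B%:R.

End WordSize.

(* Main.v *)
(* Let H be a component of the part of the tree not queried yet, of weight W.  The
   algorithm finds a cheapest S such that the components of H - S weigh at most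
   about W / 2, queries all of S in any order, and goes on with the components.
   A cheapest S is found by a knapsack recursion over the tree, with the weights
   rounded down to multiples of W / (2 n K); the parts then weigh at most
   (K + 1) / (2 K) W, where K is of the order of 1 / eps.

   For a decision tree D', let D'_q be the set of targets whose search in D'
   queries q, so that cost(D') is the sum of c(q) w(D'_q).  The vertices q of H
   with 2 w(D'_q & H) > W separate H into parts of weight at most W / 2, since a
   connected set C of the remaining ones lies in D'_q for the q in C queried
   first.  So W c(S) is at most the sum of c(q) W over these q.  For a fixed q the
   sets H containing q decrease geometrically in weight, so that the sum of those
   W with 2 w(D'_q & H) > W is at most 2 K / (K - 1) times the first, that is, at
   most 4 K / (K - 1) w(D'_q).  Summing over q, the cost of the result is at most
   4 K / (K - 1) times that of D'. *)
Require Import Defs.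
From HB Require Import structures.
From mathcomp Require Import all_boot all_order all_algebra.
From mathcomp Require Import boolp reals zify lra.

Set Implicit Arguments.
Unset Strict Implicit.
Unset Printing Implicit Defensive.

(** * Components and decision trees *)

(** The running time fixes the design. With R = n K + 1 rows, one round of knapsack tables takes O(n
    R^2) steps, so O(n^4 / eps^2) leaves room for n rounds. Hence every phase must query at least
    one vertex, even when its component has weight 0 and the cheapest separating set may be empty.
    Only the weights are rounded; the query costs stay exact. Rounding down keeps every set leaving
    parts of weight at most W / 2 admissible, so S is no dearer than any of these. All the error
    goes into the size of the parts, where a factor (K + 1) / (2 K) < 1 still yields a geometric
    series. The order of the queries within S is free because the analysis charges all of c(S) to
    every target of the component; a target outside the component never meets a vertex of S on its
    search path. On the machine, numbers must stay below a fixed power of n + M + 1 / eps, M being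
    the largest input number. Time and absence of overflow are made syntactic as far as possible:
    the programs have bounded loops only, their time and the size of their values are computed from
    their text, and a few writes need a semantic bound. *)

Section Components.
Variables (V : finType) (e : rel V).
Hypothesis e_sym : symmetric e.
Implicit Types A B C : {set V}.

(** For [x \in A] this is literally the block of [x] in [components e A]; for [x \notin A] it is
    empty. *)
Definition comp (A : {set V}) (x : V) : {set V} :=
  [set y in A | connect (induced e A) x y].

Lemma inducedE A x y : induced e A x y = [&& x \in A, y \in A & e x y].
Proof. by []. Qed.

Lemma induced_sym A : connect_sym (induced e A).
Proof. by apply: sym_connect_sym => x y; rewrite !inducedE e_sym andbCA. Qed.

Lemma induced_mono (A B : {set V}) :
  A \subset B -> subrel (connect (induced e A)) (connect (induced e B)).
Proof.
move=> AB; apply: connect_sub => x y /and3P[xA yA exy].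
by apply: connect1; rewrite inducedE !(subsetP AB).
Qed.

Lemma comp_sub A x : comp A x \subset A.
Proof. by apply/subsetP => y; rewrite inE => /andP[]. Qed.

Lemma mem_comp A x : x \in A -> x \in comp A x.
Proof. by move=> xA; rewrite inE xA connect0. Qed.

Lemma comp_eq A x y : y \in comp A x -> comp A y = comp A x.
Proof.
rewrite inE => /andP[yA cxy]; apply/setP => z; rewrite !inE.
by rewrite (same_connect (@induced_sym A) cxy).
Qed.

Lemma comp_mono (A B : {set V}) x : A \subset B -> comp A x \subset comp B x.
Proof.
move=> AB; apply/subsetP => y; rewrite !inE => /andP[yA c].
by rewrite (subsetP AB) //= (induced_mono AB).
Qed.

Lemma comp_symm A x y : x \in A -> y \in comp A x -> x \in comp A y.
Proof. by move=> xA /comp_eq ->; apply: mem_comp. Qed.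

(** A path from [x] inside [B] never leaves [comp A x], hence stays in [C]. This gives both
    localisations of a deletion below: it does not affect other components, and within its own
    component it may be computed there. *)
Lemma comp_restrict (A B C : {set V}) x :
  B \subset A -> x \in B -> B :&: comp A x \subset C -> C \subset B ->
  comp C x = comp B x.
Proof.
move=> BA xB BC CB; apply/eqP; rewrite eqEsubset comp_mono //=.
have xC : x \in C by rewrite (subsetP BC) // inE xB mem_comp // (subsetP BA).
apply/subsetP => y; rewrite inE => /andP[_ /connectP[p px ->]].
elim/last_ind: p px => [|p z IHp]; first by rewrite mem_comp.
rewrite rcons_path last_rcons => /andP[/[dup] px /IHp lC /and3P[lB zB ez]].
have zC : z \in C.
  rewrite (subsetP BC) // inE zB inE (subsetP BA) //=.
  apply: (induced_mono BA); apply/connectP; exists (rcons p z).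
    by rewrite rcons_path px inducedE lB zB.
  by rewrite last_rcons.
move: lC; rewrite !inE zC /= => /andP[lC c]; apply: connect_trans c _.
by apply: connect1; rewrite inducedE lC zC.
Qed.

Lemma comp_out (A : {set V}) s x :
  x \in A -> x \notin comp A s -> comp (A :\ s) x = comp A x.
Proof.
move=> xA xs; apply: (@comp_restrict A) => //; last exact: subD1set.
apply/subsetP => y; rewrite !inE => /andP[-> /andP[_ cxy]]; rewrite andbT.
by apply: contra xs => /eqP <-; rewrite inE xA induced_sym.
Qed.

Lemma comp_in (A : {set V}) s x :
  s \in A -> x \in comp A s :\ s -> comp (comp A s :\ s) x = comp (A :\ s) x.
Proof.
move=> sA /setD1P[xs xc]; apply: (@comp_restrict A).
- exact: subD1set.
- by rewrite !inE xs (subsetP (comp_sub A s)).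
- rewrite (comp_eq xc); apply/subsetP => y; rewrite in_setI !in_setD1.
  by case/andP => /andP[-> _] ->.
- exact: setSD (comp_sub _ _).
Qed.

Definition connected_set (C : {set V}) :=
  forall x y, x \in C -> y \in C -> connect (induced e C) x y.

End Components.

(** * Decision trees: first queries, and trees obtained by successive deletions *)

Section DecisionTrees.
Variables (V : finType) (e : rel V).
Hypothesis e_sym : symmetric e.
Implicit Types (D : rooted_tree V) (A S C : {set V}).

(** The recursive occurrence sits below an [exists2], so the generated principle has no induction
    hypothesis for the children. *)
Lemma decision_tree_on_ind' (P : rooted_tree V -> {set V} -> V -> Prop) :
  (forall D S r, r \in S ->
     (forall H, H \in components e (S :\ r) ->
        exists s, [/\ D s = Some r, decision_tree_on e D H s & P D H s]) ->
     P D S r) ->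
  forall D S r, decision_tree_on e D S r -> P D S r.
Proof.
move=> IH; fix F 4 => D S r [S' r' rS H]; apply: IH => // H' /H[s Ds dts].
by exists s; split=> //; apply: F.
Qed.

Definition up_path D k (o : option V) := if o is Some y then path_down D k y else [::].

(* The vertex [q] of [C] is the one that is queried first. *)
Lemma first_query D S r : decision_tree_on e D S r ->
  forall C, C \subset S -> C != set0 -> connected_set e C ->
  exists2 q, q \in C & forall x, x \in C -> exists l,
    [/\ uniq l, {subset l <= S}, q \in l &
        forall k, path_down D (size l + k) x = up_path D k (D r) ++ l].
Proof.
move=> dt; elim/decision_tree_on_ind': dt => {}D {}S {}r rS IH.
(* Without [r], the connected set [C] lies in a single component of [S :\ r] and the recursion
   applies. The extra conclusion [r \in l] serves the case [r \in C], where this is applied to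
   singletons. *)
have key : forall C, C \subset S -> C != set0 -> connected_set e C ->
    r \notin C -> exists2 q, q \in C & forall x, x \in C -> exists l,
    [/\ uniq l, {subset l <= S}, q \in l & r \in l /\
        forall k, path_down D (size l + k) x = up_path D k (D r) ++ l].
  move=> C CS /set0Pn[y yC] Cc rC.
  have CSr : C \subset S :\ r by rewrite subsetD1 CS.
  have yS : y \in S :\ r by rewrite (subsetP CSr).
  have [|s [Ds _ P]] := IH (comp e (S :\ r) y).
    by rewrite /components /equivalence_partition; apply: imset_f.
  have [||q qC Q] := P C _ _ Cc; first 1 last.
  - by apply/set0Pn; exists y.
  - exists q => // x /Q[l [ul lS ql E]]; exists (r :: l); split.
    - rewrite /= ul andbT; apply/negP => /lS.
      by move/(subsetP (comp_sub e _ _)); rewrite !inE eqxx.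
    - move=> z; rewrite inE => /predU1P[->//|/lS].
      by move/(subsetP (comp_sub e _ _)); rewrite !inE => /andP[].
    - by rewrite inE ql orbT.
    - split; first exact: mem_head.
      by move=> k; rewrite [size _]/= addSnnS E Ds /= -cats1 -catA.
  - apply/subsetP => z zC; rewrite inE (subsetP CSr) //=.
    by apply: induced_mono CSr _ _ _; apply: Cc.
move=> C CS C0 Cc; have [rC|rC] := boolP (r \in C); last first.
  have [q qC Q] := key C CS C0 Cc rC; exists q => // x /Q[l [ul lS ql [rl E]]].
  by exists l.
exists r => // x xC; have [->|xr] := eqVneq x r.
  exists [:: r]; split=> //; first by move=> z; rewrite inE => /eqP ->.
    by rewrite mem_head.
  by move=> k; rewrite add1n /= cats1.
have [||||q qx Q] := key [set x]; first 1 last.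
- by apply/set0Pn; exists x; rewrite set11.
- by move=> y z /set1P -> /set1P ->.
- by rewrite inE eq_sym.
- by have [l [ul lS _ [rl E]]] := Q x (set11 x); exists l.
- by rewrite sub1set (subsetP CS).
Qed.

Lemma first_query_queries D C : decision_tree e D -> C != set0 ->
  connected_set e C ->
  exists2 q, q \in C & forall x, x \in C -> uniq (queries D x) /\ q \in queries D x.
Proof.
move=> [r Dr dt] C0 Cc; have [q qC Q] := first_query dt (subsetT C) C0 Cc.
exists q => // x /Q[l [ul _ ql E]].
(* The path is duplicate-free, so the fuel [#|V|] of [queries] covers it; the surplus is the [k] of
   [first_query]. *)
have ln : size l <= #|V| by rewrite -(card_uniqP ul) max_card.
by rewrite /queries -(subnKC ln) E Dr.
Qed.

Lemma uniq_queries D x : decision_tree e D -> uniq (queries D x).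
Proof.
move=> dt; have [||q] := first_query_queries (C := [set x]) dt.
- by apply/set0Pn; exists x; rewrite set11.
- by move=> y z /set1P -> /set1P ->.
by move=> _ /(_ x (set11 x))[].
Qed.

Definition weight (w : V -> nat) A := \sum_(x in A) w x.

Definition subtree D q := [set x | q \in queries D x].

Definition costs (c : V -> nat) A := \sum_(x in A) c x.

Lemma cost_subtrees (c w : V -> nat) D : decision_tree e D ->
  cost c w D = \sum_q c q * weight w (subtree D q).
Proof.
move=> dt; rewrite /cost /weight.
under eq_bigr => x _ do rewrite (big_uniq _ (uniq_queries x dt)) big_distrr /=.
under [RHS]eq_bigr => q _ do rewrite big_distrr /=.
rewrite (exchange_big_dep predT) //=; apply: eq_bigr => q _.
by apply: eq_big => x; [rewrite inE | rewrite mulnC].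
Qed.

Lemma weight_sub (w : V -> nat) A S : A \subset S -> weight w A <= weight w S.
Proof.
move=> AS; rewrite /weight [leqLHS]big_mkcond [leqRHS]big_mkcond.
by apply: leq_sum => x _; case: ifP => // /(subsetP AS) ->.
Qed.

Definition heavy w D A := [set q in A | weight w A < 2 * weight w (subtree D q :&: A)].

Lemma heavy_separates w D A C : decision_tree e D -> connected_set e C ->
  C != set0 -> C \subset A :\: heavy w D A -> 2 * weight w C <= weight w A.
Proof.
move=> dt Cc C0 CA; have [q qC Q] := first_query_queries dt C0 Cc.
have := subsetP CA q qC; rewrite !inE => /andP[+ qA]; rewrite qA /= -leqNgt.
apply: leq_trans; rewrite leq_mul2l /=; apply: weight_sub.
apply/subsetP => x xC; rewrite !inE (Q x xC).2.
by have := subsetP CA x xC; rewrite !inE => /andP[].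
Qed.

(* A state consists of the vertices not queried yet and of the current parents;
   until a vertex is queried, its parent is the last query in its component. *)
Definition elim_step (st : {set V} * rooted_tree V) (s : V) :=
  (st.1 :\ s,
   [ffun v => if (v \in comp e st.1 s) && (v != s) then Some s else st.2 v]).

Definition elim := foldl elim_step.

Lemma elim_rest st l : (elim st l).1 = st.1 :\: [set s in l].
Proof.
elim: l st => [|s l IH] st /=; first by apply/setP => x; rewrite !inE.
by rewrite IH; apply/setP => x; rewrite !inE; case: (x \in l); case: (x == s).
Qed.

Lemma elim_step_out A D s v : v \notin A -> (elim_step (A, D) s).2 v = D v.
Proof. by move=> vA; rewrite ffunE inE (negbTE vA). Qed.

Lemma elim_out A D l v : v \notin A -> (elim (A, D) l).2 v = D v.
Proof.
elim: l A D => [|s l IH] A D vA //.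
rewrite [elim _ _]/= [elim_step _ _]surjective_pairing IH ?elim_step_out //.
by rewrite !inE negb_and vA orbT.
Qed.

(** The first vertex of [l] in a component becomes its root and keeps the label it had, which is
    common to the component; it then becomes the common label of the parts it leaves. So the
    equation for the label of the root is what attaches the subtree to its parent. *)
Lemma elim_decision_tree_on A D l x : uniq l -> l =i A ->
  (forall x y, x \in A -> y \in comp e A x -> D x = D y) -> x \in A ->
  exists r, [/\ r \in comp e A x, (elim (A, D) l).2 r = D r &
    decision_tree_on e (elim (A, D) l).2 (comp e A x) r].
Proof.
elim: l A D x => [|s l IH] A D x; first by move=> _ lA _; rewrite -lA.
move=> /andP[sl ul] lA Dc xA; rewrite [elim _ _]/= [elim_step _ _]surjective_pairing.
have sA : s \in A by rewrite -lA mem_head.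
set A1 := A :\ s; set D1 := (elim_step (A, D) s).2.
have D1E v : D1 v = if (v \in comp e A s) && (v != s) then Some s else D v.
  by rewrite /D1 ffunE.
have lA1 : l =i A1.
  move=> y; rewrite !inE -lA inE; case: eqVneq => [->|] //=; exact: negbTE.
have comp_s y z : y \in A -> z \in comp e A y -> (z \in comp e A s) = (y \in comp e A s).
  move=> yA zy; apply/idP/idP => h.
    by rewrite -(comp_eq e_sym h) comp_symm.
  by rewrite -(comp_eq e_sym h).
have D1c y z : y \in A1 -> z \in comp e A1 y -> D1 y = D1 z.
  move=> yA zy; have zA : z \in A1 by apply: subsetP zy; apply: comp_sub.
  have yA' : y \in A by case/setD1P: yA.
  have zy' : z \in comp e A y by apply: subsetP zy; apply: comp_mono; apply: subD1set.
  rewrite !D1E (comp_s _ _ yA' zy'); case/setD1P: yA => -> _; case/setD1P: zA => -> _.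
  by case: ifP => // _; apply: Dc.
have IH' := IH A1 D1 _ ul lA1 D1c; rewrite -/A1 -/D1.
have [xs|xs] := boolP (x \in comp e A s); last first.
  have xA1 : x \in A1.
    by rewrite !inE xA andbT; apply: contra xs => /eqP ->; apply: mem_comp.
  have [r [rx Dr dt]] := IH' x xA1; rewrite (comp_out e_sym xA xs) in rx dt.
  exists r; split=> //; rewrite Dr D1E (comp_s _ _ xA rx) (negbTE xs) //.
rewrite (comp_eq e_sym xs); exists s; split; first exact: mem_comp.
  by rewrite elim_out ?D1E ?eqxx ?andbF // !inE eqxx.
apply: DecisionTreeOn; first exact: mem_comp.
move=> H /imsetP[y yS ->]; rewrite -/(comp e (comp e A s :\ s) y).
have yA1 : y \in A1 by case/setD1P: (yS) => ys yc; rewrite !inE ys (subsetP (comp_sub e A s)).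
rewrite (comp_in e_sym sA yS); have [r [ry Dr dt]] := IH' y yA1; exists r => //.
rewrite Dr -(D1c y r yA1 ry) D1E; case/setD1P: yS => -> ->; by [].
Qed.

Lemma elim_labels (st : {set V} * rooted_tree V) l :
  (forall v y, st.2 v = Some y -> y \notin st.1) ->
  forall v y, (elim st l).2 v = Some y -> y \notin (elim st l).1.
Proof.
elim: l st => [|s l IH] st h //; apply: (IH (elim_step st s)) => v y.
rewrite ffunE !inE; case: ifP => _; first by move=> [<-]; rewrite eqxx.
by move=> /h yA; rewrite negb_and yA orbT.
Qed.

(** A vertex is relabelled only by a query in its own current component, and components only shrink.
    Climbing the parents from [x] as long as they are in [A] thus stays in [comp e A x]. *)
Lemma elim_parent A D l : uniq l -> {subset l <= A} ->
  (forall v y, D v = Some y -> y \notin A) ->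
  forall x, ((elim (A, D) l).2 x = D x \/
             exists2 y, (elim (A, D) l).2 x = Some y & y \in A) /\
    forall y, y \in A -> x \in A -> (elim (A, D) l).2 x = Some y -> y \in comp e A x.
Proof.
elim: l A D => [|s l IH] A D.
  by move=> _ _ h x; split; [left | move=> y yA _ /h; rewrite yA].
move=> /andP[sl ul] lA h x; rewrite [elim _ _]/= [elim_step _ _]surjective_pairing.
have sA : s \in A by rewrite lA ?mem_head.
set A1 := A :\ s; set D1 := (elim_step (A, D) s).2.
have D1E v : D1 v = if (v \in comp e A s) && (v != s) then Some s else D v.
  by rewrite /D1 ffunE.
have lA1 : {subset l <= A1}.
  move=> y yl; rewrite !inE lA ?inE ?yl ?orbT // andbT.
  by apply: contraNneq sl => <-.
have h1 v y : D1 v = Some y -> y \notin A1.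
  rewrite D1E; case: ifP => _; first by move=> [<-]; rewrite !inE eqxx.
  by move=> /h yA; rewrite !inE negb_and yA orbT.
have [I1 I2] := IH A1 D1 ul lA1 h1 x; rewrite -/A1 -/D1.
set D' := (elim (A1, D1) l).2 in I1 I2 *; split.
  case: I1 => [->|[y ->]].
    by rewrite D1E; case: ifP => _; [right; exists s | left].
  by case/setD1P => _ yA; right; exists y.
move=> y yA xA Dxy.
case: I1 => [E|[z]]; last first.
  rewrite Dxy => -[<-] yA1; have [xs|xs] := eqVneq x s.
    by move: Dxy; rewrite xs /D' elim_out ?D1E ?eqxx ?andbF /= ?inE ?eqxx // => /h; rewrite yA.
  have : y \in comp e A1 x by apply: I2 => //; rewrite !inE xs.
  by apply: subsetP; apply: comp_mono; apply: subD1set.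
move: Dxy; rewrite E D1E; case: ifP => [/andP[xs _] [<-]|_ /h]; last by rewrite yA.
exact: comp_symm.
Qed.

Lemma elim_queries A D l k x q : uniq l -> {subset l <= A} ->
  (forall v y, D v = Some y -> y \notin A) ->
  q \in path_down (elim (A, D) l).2 k x -> q \in A -> x \in A /\ q \in comp e A x.
Proof.
move=> ul lA h; set D' := (elim _ _).2.
elim: k x => [|k IH] x //=; rewrite mem_rcons inE => /predU1P[->|].
  by move=> xA; split=> //; apply: mem_comp.
have [I1 I2] := elim_parent ul lA h x; rewrite -/D' in I1 I2.
case E: (D' x) => [y|] // qy qA; have [yA qcy] := IH y qy qA.
have [xA|xA] := boolP (x \in A); last first.
  by move: E; rewrite /D' elim_out // => /h; rewrite yA.
by split=> //; rewrite -(comp_eq e_sym (I2 y yA xA E)).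
Qed.

End DecisionTrees.

(** * Phases and the approximation bound *)

Section Phases.
Variables (V : finType) (e : rel V) (c w : V -> nat) (K : nat).
Hypothesis e_sym : symmetric e.
Implicit Types (D : rooted_tree V) (A S H : {set V}).

(* [p.1] is a component of [A], and [p.2] lists a cheap set of vertices splitting
   it into parts of at most [(K + 1) / (2 * K)] of its weight. *)
Definition phase_ok A (p : {set V} * seq V) := 
  [/\ exists2 x, x \in A & p.1 = comp e A x,
      uniq p.2, {subset p.2 <= p.1},
      forall v, v \in p.1 -> v \notin p.2 ->
        2 * K * weight w (comp e (A :\: [set s in p.2]) v) <= K.+1 * weight w p.1 &
      forall S, S \subset p.1 ->
        (forall C, C != set0 -> connected_set e C -> C \subset p.1 :\: S ->
           2 * weight w C <= weight w p.1) ->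
        weight w p.1 * \sum_(s <- p.2) c s <= weight w p.1 * costs c S].

Definition queried (h : seq ({set V} * seq V)) := flatten [seq p.2 | p <- h].

Fixpoint phases A (h : seq ({set V} * seq V)) : Prop :=
  if h is p :: h' then phase_ok A p /\ phases (A :\: [set s in p.2]) h' else True.

Lemma phases_rcons A h p :
  phases A h -> phase_ok (A :\: [set s in queried h]) p -> phases A (rcons h p).
Proof.
elim: h A => [|q h IH] A /=.
  by move=> _ ok; split=> //; move: ok; congr phase_ok; apply/setP => x; rewrite !inE.
move=> [okq hh] ok; split=> //; apply: IH => //; move: ok; congr phase_ok.
by apply/setP => x; rewrite !inE mem_cat negb_or -andbA; do !case: (x \in _).
Qed.

Lemma phase_sub A p : phase_ok A p -> {subset p.2 <= A}.
Proof. by case=> -[x _ E] _ sub _ _ y /sub; rewrite E; apply: subsetP (comp_sub _ _ _) _. Qed.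

Lemma phases_uniq A h : phases A h -> uniq (queried h) /\ {subset queried h <= A}.
Proof.
elim: h A => [|p h IH] A //= [ok /IH[uh sh]]; have sp := phase_sub ok.
rewrite /queried /= cat_uniq; split.
  case: ok => _ -> _ _ _ /=; rewrite uh andbT; apply/hasPn => x /sh.
  by rewrite !inE => /andP[].
by move=> x; rewrite mem_cat => /orP[/sp|/sh] //; rewrite inE => /andP[].
Qed.

(** A vertex of [p.2] on the search path of [x] lies in the component of [x] at the start of the
    phase, by [elim_queries]. So [x] pays for [p] only if [x \in p.1], and then at most for all of
    [p.2]. *)
Lemma queries_phases A D h x : phases A h ->
  (forall v y, D v = Some y -> y \notin A) ->
  \sum_(q | (q \in queries (elim e (A, D) (queried h)).2 x) && (q \in queried h)) c q
  <= \sum_(p <- h | x \in p.1) \sum_(s <- p.2) c s.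
Proof.
elim: h A D => [|p h IH] A D; first by move=> _ _; rewrite big1 // => q; rewrite andbF.
move=> /= [ok hh] hD; have [uq sq] := phases_uniq (conj ok hh : phases A (p :: h)).
rewrite /queried /= -/(queried h) in uq sq *.
rewrite /elim foldl_cat -/(elim e (A, D) p.2) -/(elim e (elim e (A, D) p.2) (queried h)).
have -> : elim e (A, D) p.2 = (A :\: [set s in p.2], (elim e (A, D) p.2).2).
  by rewrite [LHS]surjective_pairing elim_rest.
set A1 := A :\: _; set D1 := (elim e (A, D) p.2).2.
have D'E : (elim e (A1, D1) (queried h)).2 = (elim e (A, D) (p.2 ++ queried h)).2.
  rewrite /elim foldl_cat -/(elim e (A, D) p.2); congr (foldl _ _ _).2.
  by rewrite [RHS]surjective_pairing -/(elim e (A, D) p.2) elim_rest.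
set D' := (elim e _ (queried h)).2 in D'E *.
have [[z zA pE] up sp _ _] := ok.
have hD1 v y : D1 v = Some y -> y \notin A1.
  by move=> Dv; have := elim_labels (st := (A, D)) hD Dv; rewrite elim_rest.
have /= := IH A1 D1 hh hD1; rewrite -/D' big_cons => IH'.
have sub q : q \in queries D' x -> q \in A -> x \in A /\ q \in comp e A x.
  by rewrite D'E; apply: elim_queries.
case: ifP => xp.
  rewrite (bigID (mem p.2)) /=; apply: leq_add.
    rewrite big_uniq //= [leqLHS]big_mkcond [leqRHS]big_mkcond; apply: leq_sum => q _.
    by rewrite andbC; case: (q \in p.2) => //=; case: ifP.
  apply: leq_trans IH'; rewrite [leqLHS]big_mkcond [leqRHS]big_mkcond; apply: leq_sum => q _.
  by rewrite mem_cat; case: (q \in p.2); rewrite ?andbF //= andbT.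
apply: leq_trans IH'; rewrite [leqLHS]big_mkcond [leqRHS]big_mkcond; apply: leq_sum => q _.
rewrite mem_cat; case: (boolP (q \in p.2)) => //= qp.
case: ifP => // /andP[qx _]; have [xA qcx] := sub q qx (phase_sub ok qp).
have := sp _ qp; rewrite pE => qz.
move: xp; rewrite pE -(comp_eq e_sym qz) (comp_eq e_sym qcx).
by rewrite mem_comp.
Qed.

Lemma phase_heavy A p D : decision_tree e D -> phase_ok A p ->
  weight w p.1 * \sum_(s <- p.2) c s <= weight w p.1 * costs c (heavy w D p.1).
Proof.
move=> dt [_ _ _ _]; apply; first by apply/subsetP => x; rewrite inE => /andP[].
by move=> C C0 Cc CA; apply: heavy_separates dt Cc C0 CA.
Qed.

Lemma phases_out A h q : phases A h -> q \notin A ->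
  \sum_(p <- h | q \in p.1) weight w p.1 = 0.
Proof.
elim: h A => [|p h IH] A /=; first by rewrite big_nil.
move=> [[[y yB E] _ _ _ _] hh] qA; rewrite big_cons ifN.
  by apply: IH hh _; rewrite !inE negb_and qA orbT.
by apply: contra qA; rewrite E; apply: subsetP; apply: comp_sub.
Qed.

(** The geometric series without division: if the next component of [q] has weight W' with 2 K W' <=
    (K + 1) W, then (K - 1) W + 2 K W' <= 2 K W. Once [q] is queried, no later component contains
    it. *)
Lemma phases_chain A h q : phases A h -> q \in A ->
  K.-1 * \sum_(p <- h | q \in p.1) weight w p.1 <= 2 * K * weight w (comp e A q).
Proof.
elim: h A => [|p h IH] A; first by rewrite big_nil muln0.
move=> /= [ok hh] qA; rewrite big_cons; set A1 := A :\: _ in hh.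
have [[z zA pE] up sp split _] := ok.
have cmono : weight w (comp e A1 q) <= weight w (comp e A q).
  by apply: weight_sub; apply: comp_mono; apply: subsetDl.
case: ifP => qp; last first.
  apply: leq_trans (IH A1 hh _) _; last by rewrite leq_mul2l cmono orbT.
  by rewrite /A1 !inE qA andbT; apply: contraFN qp; apply: sp.
have cE : comp e A q = p.1 by move: qp; rewrite pE => /(comp_eq e_sym).
rewrite cE; have [qs|qs] := boolP (q \in p.2).
  by rewrite (phases_out hh) ?addn0 ?inE ?qs //; apply: leq_mul => //; lia.
have qA1 : q \in A1 by rewrite /A1 !inE qs.
have := IH A1 hh qA1; have := split q qp qs; rewrite -/A1; nia.
Qed.

(** [phases_chain] is applied from the first phase at which [q] is heavy; the weight there is less
    than 2 w(D_q). *)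
Lemma phases_heavy A h D q : phases A h ->
  K.-1 * \sum_(p <- h | q \in heavy w D p.1) weight w p.1
  <= 4 * K * weight w (subtree D q).
Proof.
elim: h A => [|p h IH] A; first by rewrite big_nil muln0.
move=> /[dup] hph /= [ok hh]; rewrite big_cons; case: ifP => [qh|_]; last exact: IH hh.
have [qp hw] : q \in p.1 /\ weight w p.1 < 2 * weight w (subtree D q :&: p.1).
  by move: qh; rewrite inE => /andP[].
have [[z zA pE] _ _ _ _] := ok.
have qA : q \in A by apply: subsetP qp; rewrite pE comp_sub.
have := phases_chain hph qA; rewrite big_cons qp.
have -> : comp e A q = p.1 by move: qp; rewrite pE => /(comp_eq e_sym).
have : weight w (subtree D q :&: p.1) <= weight w (subtree D q).
  by apply: weight_sub; apply: subsetIl.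
have : \sum_(j <- h | q \in heavy w D j.1) weight w j.1 <=
       \sum_(j <- h | q \in j.1) weight w j.1.
  rewrite [leqLHS]big_mkcond [leqRHS]big_mkcond; apply: leq_sum => j _.
  by rewrite inE; case: (q \in j.1) => //=; case: ifP.
nia.
Qed.

Theorem phases_approx h :
  (forall x y, connect e x y) -> 0 < #|V| ->
  phases [set: V] h -> queried h =i [set: V] ->
  let D := (elim e ([set: V], [ffun=> None]) (queried h)).2 in
  decision_tree e D /\
  forall D', decision_tree e D' -> K.-1 * cost c w D <= 4 * K * cost c w D'.
Proof.
move=> conn /card_gt0P[x0 _] hh hT D; have [uq _] := phases_uniq hh.
have compT x : comp e setT x = setT.
  apply/setP => y; rewrite !inE -[RHS](conn x y).
  by apply: eq_connect => u v; rewrite inducedE !inE.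
have dt : decision_tree e D.
  have [||r [_ Dr dt]] := elim_decision_tree_on (D := [ffun=> None]) e_sym uq hT (x := x0).
  - by move=> x y; rewrite !ffunE.
  - by rewrite inE.
  by exists r; [rewrite Dr ffunE | rewrite compT in dt].
split=> // D' dt'.
have -> : cost c w D = \sum_x w x * \sum_(q | (q \in queries D x) && (q \in queried h)) c q.
  apply: eq_bigr => x _; congr (_ * _); rewrite big_uniq /=; last exact: uniq_queries dt.
  by apply: eq_bigl => q; rewrite hT inE andbT.
have h0 (v y : V) : ([ffun=> None] : rooted_tree V) v = Some y -> y \notin [set: V].
  by rewrite ffunE.
(* Each target is charged the full cost of every phase whose component contains it. *)
apply: (@leq_trans (K.-1 * \sum_x w x * \sum_(p <- h | x \in p.1) \sum_(s <- p.2) c s)).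
  rewrite leq_mul2l leq_sum ?orbT // => x _; rewrite leq_mul2l queries_phases ?orbT //.
(* Summed over the targets, a phase costs W c(S), and the heavy vertices of [D'] are a competitor of
   S. *)
apply: (@leq_trans (K.-1 * \sum_(p <- h) weight w p.1 * costs c (heavy w D' p.1))).
  rewrite leq_mul2l; apply/orP; right.
  under eq_bigr do rewrite big_distrr /=.
  rewrite (exchange_big_dep predT) //= big_seq [leqRHS]big_seq.
  apply: leq_sum => p ph; rewrite -big_distrl /= -/(weight w p.1).
  suff [A ok] : exists A, phase_ok A p by apply: phase_heavy ok.
  move: {uq hT D dt} [set: V] hh ph => A; elim: h A => [|p' h IH] A //= [ok hh].
  by rewrite inE => /predU1P[->|/(IH _ hh)]; first exists A.
(* The sums are exchanged once more, so that each vertex [q] is charged for the phases at which it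
   is heavy. *)
rewrite (cost_subtrees c w dt') /costs.
under eq_bigr do rewrite big_distrr /=.
rewrite (exchange_big_dep predT) //= !big_distrr /=; apply: leq_sum => q _.
rewrite -big_distrl /= mulnA [leqRHS]mulnCA mulnC leq_mul2l (phases_heavy _ _ hh) orbT //.
Qed.

End Phases.

(** * Elimination orders of forests *)

(** Otherwise a simple path in [U] can always be prolonged at its first vertex, by a neighbour other
    than the second vertex. The new vertex is fresh since the tree has no cycle, so simple paths of
    any length would exist. *)
Lemma tree_leaf (V : finType) (e : rel V) (U : {set V}) :
  is_tree e -> U != set0 -> exists2 v, v \in U & #|[set u in U | e v u]| <= 1.
Proof.
move=> [[e_sym e_irr _ _] acyc] /set0Pn[u0 u0U].
have [/existsP[v /andP[vU v1]]|/existsPn noleaf] :=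
  boolP [exists v, (v \in U) && (#|[set u in U | e v u]| <= 1)]; first by exists v.
have long m : exists x p, [/\ size p = m, path e x p, uniq (x :: p) & {subset x :: p <= U}].
  elim: m => [|m [x [p [sp px up pU]]]].
    by exists u0, [::]; split=> // y; rewrite inE => /eqP ->.
  have xU : x \in U by rewrite pU ?mem_head.
  have := noleaf x; rewrite xU /= -ltnNge => n2.
  have [y yU /andP[exy yp]] : exists2 y, y \in U & e x y && (y != head x p).
    (* [head x p] is the second vertex of the path, or [x] itself, which is not its own neighbour,
       if there is none. *)
    have /card_gt0P[y] : 0 < #|[set u in U | e x u] :\ head x p|.
      by rewrite (cardsD1 (head x p)) in n2; move: n2; case: (_ \in _) => /=; lia.
    by rewrite !inE => /and3P[yh yU exy]; exists y => //; rewrite exy.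
  have yx : y != x by apply: contraTneq exy => ->; rewrite e_irr.
  exists y, (x :: p); split=> /=; first by rewrite sp.
  - by rewrite e_sym exy.
  - rewrite inE negb_or yx /= andbC; move: (up) => /= -> /=.
    apply/negP => yip; case/splitPr: yip sp px up yp {pU} => p1 p2 _ px up yp.
    have := acyc (x :: rcons p1 y); apply.
      by case: p1 {px up} yp => [|z p1] //=; rewrite ?eqxx // size_rcons.
    rewrite /ucycle /= rcons_path last_rcons; move: px; rewrite -cat_rcons cat_path.
    move=> /andP[-> _]; rewrite e_sym exy /=.
    by move: up; rewrite -cat_rcons -cat_cons cat_uniq => /and3P[].
  - by move=> z; rewrite inE => /predU1P[->|/pU].
have [x [p [sp _ up _]]] := long #|V|.
by have := max_card (mem (x :: p)); rewrite (card_uniqP up) /= sp ltnn.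
Qed.

Section Forest.
Variables (V : finType) (e : rel V) (par : V -> option V) (rk : V -> nat).
Hypothesis rk_par : forall x y, par x = Some y -> rk x < rk y.
Hypothesis e_par : forall x y, e x y = (par x == Some y) || (par y == Some x).
Implicit Types (A B S C X : {set V}).

Lemma forest_sym : symmetric e.
Proof. by move=> x y; rewrite !e_par orbC. Qed.

Definition up A : rel V := [rel x y | [&& x \in A, y \in A & par x == Some y]].

Lemma upE A x y : up A x y = [&& x \in A, y \in A & par x == Some y].
Proof. by []. Qed.

(** The subtree of [v] in the forest induced on [A]. The test [v \in A] makes it empty for a deleted
    [v], which [connect], being reflexive, would not do. *)
Definition desc A v := [set x in A | (v \in A) && connect (up A) x v].

Lemma desc_sub A v : desc A v \subset A.
Proof. by apply/subsetP => x; rewrite inE => /andP[]. Qed.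

Lemma mem_desc A v : v \in A -> v \in desc A v.
Proof. by move=> vA; rewrite !inE vA connect0. Qed.

Lemma desc_out A v : v \notin A -> desc A v = set0.
Proof. by move=> /negbTE vA; apply/setP => x; rewrite !inE vA andbF. Qed.

Lemma desc_mono A B v : A \subset B -> desc A v \subset desc B v.
Proof.
move=> AB; apply/subsetP => x; rewrite !inE => /and3P[xA vA c].
rewrite !(subsetP AB) //=; apply: connect_sub c => y z /and3P[yA zA yz].
by apply: connect1; rewrite upE !(subsetP AB).
Qed.

Lemma up_rk A x y : connect (up A) x y -> x != y -> rk x < rk y.
Proof.
move=> /connectP[p]; elim: p x => [|z p IH] x /=; first by move=> _ ->; rewrite eqxx.
move=> /andP[/and3P[_ _ /eqP xz] pz] yE _; have lt := rk_par xz.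
have [->//|zy] := eqVneq y z; apply: leq_trans lt _; apply: ltnW; apply: IH pz yE _.
by rewrite eq_sym.
Qed.

Lemma connect_up_step A x y : connect (up A) x y -> x != y ->
  exists z, up A x z /\ connect (up A) z y.
Proof.
move=> /connectP[[|z p] /=]; first by move=> _ ->; rewrite eqxx.
by move=> /andP[xz pz] -> _; exists z; split=> //; apply/connectP; exists p.
Qed.

Lemma up_linear A x y z : connect (up A) x y -> connect (up A) x z ->
  connect (up A) y z || connect (up A) z y.
Proof.
move=> /connectP[p]; elim: p x => [|u p IH] x /=; first by move=> _ -> ->.
move=> /andP[xu pu] yE xz; have [xE|xz'] := eqVneq x z.
  rewrite orbC -xE; apply/orP; left; apply: connect_trans (connect1 xu) _.
  by apply/connectP; exists p.
have [u' [xu' c]] := connect_up_step xz xz'.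
case/and3P: xu => _ _ /eqP xu; case/and3P: xu' => _ _; rewrite xu => /eqP[uu'].
by apply: IH pu yE _; rewrite uu'.
Qed.

Definition children A v := [set u in A | par u == Some v].

Lemma desc_children A v f : v \in A ->
  \sum_(x in desc A v) f x = f v + \sum_(u in children A v) \sum_(x in desc A u) f x.
Proof.
move=> vA; rewrite (big_setD1 v) ?mem_desc //=; congr addn.
pose F u := if u \in children A v then desc A u else set0.
have -> : desc A v :\ v = \bigcup_u F u.
  apply/setP => x; rewrite !inE vA /=; apply/and3P/bigcupP => [[xv xA c]|[u _]].
    have [p pp vE] := connectP c; case: p / lastP pp vE xv => [|p z] pp vE.
      by rewrite vE eqxx.
    move: pp vE; rewrite rcons_path last_rcons => /andP[pp lz] zE _.
    rewrite -zE in lz; exists (last x p) => //; rewrite /F !inE.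
    move: lz => /and3P[-> _ ->] /=; rewrite inE xA /=.
    move: (zE) pp c => _ pp _.
    have lA : last x p \in A by case: p pp {zE} => [|y p] //=; elim: p y x xA => [|y' p IH] y x xA /=; [move=> /andP[/and3P[] //] | move=> /andP[/and3P[_ yA _]]; apply: IH].
    by rewrite ?lA /=; apply/connectP; exists p.
  rewrite /F !inE; case: ifP => [/andP[uA pu]|]; last by rewrite inE.
  rewrite !inE => /and3P[xA _ c]; have uv : up A u v by rewrite upE uA vA.
  split=> //; last exact: connect_trans c (connect1 uv).
  have lt := rk_par (eqP pu); apply/eqP => xv; move: c lt; rewrite xv => c.
  have [->|ne] := eqVneq v u; first by rewrite ltnn.
  by have := up_rk c ne; lia.
rewrite partition_disjoint_bigcup.
  rewrite [RHS]big_mkcond; apply: eq_bigr => u _; rewrite /F; case: ifP => // _.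
  by rewrite big_set0.
move=> u u' uu'; rewrite -setI_eq0; apply/eqP/setP => x; rewrite !inE /F !inE.
apply/negP => /andP[]; case: ifP => [/andP[uA pu]|]; last by rewrite inE.
move=> xu; case: ifP => [/andP[u'A pu']|]; last by rewrite inE.
move: xu; rewrite !inE => /and3P[xA _ c] /and3P[_ _ c'].
(* Two children of [v] are incomparable: a path up from one of them passes through [v], whose rank
   exceeds that of the other. *)
have bad a b : up A a v -> up A b v -> a != b -> connect (up A) a b -> False.
  move=> /and3P[_ _ /eqP av] /and3P[_ _ /eqP bv] ab /connect_up_step/(_ ab)[z [/and3P[_ _]]].
  rewrite av => /eqP[<-] vb; have := rk_par bv.
  have [->|ne] := eqVneq v b; first by rewrite ltnn.
  by have := up_rk vb ne; lia.
have uv : up A u v by rewrite upE uA vA.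
have u'v : up A u' v by rewrite upE u'A vA.
case/orP: (up_linear c c'); first exact: bad.
by apply: bad => //; rewrite eq_sym.
Qed.

Lemma desc_connected A v : connected_set e (desc A v).
Proof.
have sym := induced_sym forest_sym (desc A v).
suff H x : x \in desc A v -> connect (induced e (desc A v)) x v.
  by move=> x y /H cx /H cy; apply: connect_trans cx _; rewrite sym.
rewrite inE => /and3P[xA vA /connectP[p px vE]].
elim: p x xA px vE => [|z p IH] x xA /=; first by move=> _ ->; rewrite connect0.
move=> /andP[xz pz] vE; have zA : z \in A by case/and3P: xz.
have cz : connect (up A) z v by apply/connectP; exists p.
apply: connect_trans (connect1 _) (IH z zA pz vE).
rewrite inducedE !inE xA vA zA cz (connect_trans (connect1 xz) cz) /=.
by rewrite e_par; case/and3P: xz => _ _ ->.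
Qed.

Definition is_top A t := (t \in A) && (if par t is Some y then y \notin A else true).

(** An edge of [A] leaving the subtree of [t] could only go up from [t], whose parent is not in [A].
    Components are thus handled as subtrees of tops. *)
Lemma top_desc A t x : is_top A t -> x \in desc A t -> comp e A x = desc A t.
Proof.
move=> /andP[tA pt] xt.
have cE : comp e A t = desc A t.
  apply/eqP; rewrite eqEsubset; apply/andP; split; last first.
    apply/subsetP => y yt; rewrite inE (subsetP (desc_sub A t)) //=.
    apply: (@induced_mono _ _ (desc A t)); first exact: desc_sub.
    by apply: desc_connected => //; apply: mem_desc.
  apply/subsetP => y; rewrite inE => /andP[_ /connectP[p pp ->]].
  elim/last_ind: p pp => [|p z IH]; first by rewrite mem_desc.
  rewrite rcons_path last_rcons => /andP[/IH ly /and3P[lA zA]].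
  move: ly; set l := last t p in lA *; rewrite !inE lA tA zA /= e_par => lt.
  case/orP => [lz|zl]; last first.
    by apply: connect_trans lt; apply: connect1; rewrite upE lA zA.
  have [E|ne] := eqVneq l t; first by move: pt; rewrite -E (eqP lz) zA.
  have [z' [/and3P[_ _ /eqP lz'] c]] := connect_up_step lt ne.
  by move: (eqP lz); rewrite lz' => -[<-].
by rewrite -cE; apply: comp_eq forest_sym _ _ _ _; rewrite cE.
Qed.

Lemma top_inj A t t' : is_top A t -> is_top A t' -> t' \in desc A t -> t' = t.
Proof.
move=> _ /andP[_ pt]; rewrite inE => /and3P[_ _ c]; apply/eqP; apply: contraTT isT => ne.
have [z [/and3P[_ zA /eqP E] _]] := connect_up_step c ne.
by rewrite E zA in pt.
Qed.

Lemma exists_top A v : v \in A -> exists2 t, is_top A t & v \in desc A t.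
Proof.
move=> vA; have P0 : (v \in A) && connect (up A) v v by rewrite vA connect0.
have [t /andP[tA vt] tmax] := (@arg_maxnP V v (fun t => (t \in A) && connect (up A) v t) rk P0).
exists t; last by rewrite inE vA tA.
rewrite /is_top tA /=; case E: (par t) => [y|] //; apply/negP => yA.
have ty : up A t y by rewrite upE tA yA E eqxx.
have := tmax y; rewrite yA (connect_trans vt (connect1 ty)) => /(_ isT).
by move=> /leq_trans/(_ (leqnn _)); rewrite /= leqNgt (rk_par E).
Qed.

End Forest.

(** * The knapsack tables *)

Section Knapsack.
Variables (V : finType) (e : rel V) (par : V -> option V) (rk : V -> nat).
Hypothesis rk_par : forall x y, par x = Some y -> rk x < rk y.
Hypothesis e_par : forall x y, e x y = (par x == Some y) || (par y == Some x).
Hypothesis rk_inj : injective rk.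
Variables (A : {set V}) (c wr : V -> nat) (R : nat).
Implicit Types (S C X : {set V}).

Local Notation desc := (desc par).
Local Notation children := (children par).

(* Weight of the part of the component of [v] after deleting [S] that lies below
   [v]; it is [0] for [v \in S]. *)
Definition load S v := \sum_(x in desc (A :\: S) v) wr x.

(** Every component of [A :\: S] is the subtree of its top, so bounding all loads bounds all the
    parts left by [S] below [v]. With R = n K + 1 the bound reads: at most n K. *)
Definition light S v := [forall x in desc A v, load S x < R].

Lemma load_del S v : v \in S -> load S v = 0.
Proof. by move=> vS; rewrite /load desc_out ?big_set0 // inE vS. Qed.

Lemma load_keep S v : v \in A -> v \notin S ->
  load S v = wr v + \sum_(u in children A v) load S u.
Proof.
move=> vA vS; rewrite /load (desc_children rk_par) ?inE ?vS //; congr addn.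
rewrite [LHS]big_mkcond [RHS]big_mkcond; apply: eq_bigr => u _; rewrite !inE.
case: (boolP (u \in S)) => uS //=; case: ifP => // _.
by rewrite desc_out ?big_set0 // inE uS.
Qed.

Lemma load_anti S S' v : S \subset S' -> load S' v <= load S v.
Proof.
move=> SS; have := desc_mono par v (setDS A SS); rewrite /load => sub.
rewrite [leqLHS]big_mkcond [leqRHS]big_mkcond; apply: leq_sum => x _.
by case: ifP => // /(subsetP sub) ->.
Qed.

Lemma light_anti S S' v : S \subset S' -> light S v -> light S' v.
Proof.
move=> SS /forall_inP l; apply/forall_inP => x /l; apply: leq_ltn_trans.
exact: load_anti.
Qed.

Lemma desc_child u v : u \in children A v -> v \in A -> desc A u \subset desc A v.
Proof.
rewrite inE => /andP[uA pu] vA; apply/subsetP => x; rewrite !inE => /and3P[-> _ xu].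
by rewrite vA; apply: connect_trans xu (connect1 _); rewrite upE uA vA.
Qed.

Lemma desc_cases v x : x \in desc A v -> x = v \/ exists2 u, u \in children A v & x \in desc A u.
Proof.
rewrite inE => /and3P[xA vA /connectP[p]].
case/lastP: p => [|p z]; first by move=> _ ->; left.
rewrite rcons_path last_rcons => /andP[pp /and3P[lA zA pl]] ->; right.
exists (last x p); first by rewrite inE lA.
by rewrite inE xA lA; apply/connectP; exists p.
Qed.

Lemma light_parent S v : v \in A -> load S v < R ->
  (forall u, u \in children A v -> light S u) -> light S v.
Proof.
move=> vA lv lc; apply/forall_inP => x /desc_cases[->//|[u /lc/forall_inP l xu]].
exact: l.
Qed.

Lemma light_child S u v : v \in A -> u \in children A v -> light S v -> light S u.
Proof.
move=> vA uv /forall_inP l; apply/forall_inP => x /(subsetP (desc_child uv vA)).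
exact: l.
Qed.

Lemma light_load S v : v \in A -> light S v -> load S v < R.
Proof. by move=> vA /forall_inP; apply; apply: mem_desc. Qed.

Definition cst S v := \sum_(x in desc A v) (x \in S) * c x.

Lemma cst_children S v : v \in A ->
  cst S v = (v \in S) * c v + \sum_(u in children A v) cst S u.
Proof. by move=> vA; rewrite [LHS](desc_children rk_par). Qed.

(** Vertices are merged into their parents in the order of their ranks; these are the children of
    [u] already merged after [i] steps. *)
Definition kids i u := [set v in children A u | rk v < i].

Lemma kids_all i v : rk v <= i -> kids i v = children A v.
Proof.
move=> vi; apply/setP => x; rewrite !inE; case: (par x =P Some v) => [/rk_par xv|_].
  by rewrite (leq_trans xv vi) !andbT.
by rewrite !andbF.
Qed.

Lemma kids0 u : kids 0 u = set0.
Proof. by apply/setP => x; rewrite !inE ltn0 andbF. Qed.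

Lemma kidsS v u : kids (rk v).+1 u =
  if (v \in A) && (par v == Some u) then v |: kids (rk v) u else kids (rk v) u.
Proof.
apply/setP => x; rewrite (fun_if (fun B : {set V} => x \in B)) /kids !inE ltnS.
rewrite leq_eqVlt (inj_eq rk_inj); case: (eqVneq x v) => [->|_] /=; last by case: ifP.
by rewrite ltnn andbT andbF; case: ifP.
Qed.

(* Row [k < R] of [u] concerns the sets that avoid [u] and leave a load of at
   most [k] on its processed children; row [R] the sets that contain [u]. *)
Definition sound i (T : V -> nat -> nat) (M : V -> nat -> {set V}) := forall u, u \in A ->
  (forall k, k < R -> [/\ M u k \subset desc A u, costs c (M u k) <= T u k,
     \sum_(v in kids i u) load (M u k) v <= k & forall v, v \in kids i u -> light (M u k) v])
  /\ [/\ u \in M u R, M u R \subset desc A u, costs c (M u R) <= T u R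
     & forall v, v \in kids i u -> light (M u R) v].

(** The competitor [S] is an arbitrary set, of which only the effect on the processed children
    counts; so a single [S] can be compared at all vertices. Together with [sound], this squeezes
    the cost of the stored selections below that of every admissible set. *)
Definition optimal i (T : V -> nat -> nat) := forall u S, u \in A ->
  (forall v, v \in kids i u -> light S v) ->
  (forall k, k < R -> \sum_(v in kids i u) load S v <= k ->
     T u k <= \sum_(v in kids i u) cst S v)
  /\ T u R <= c u + \sum_(v in kids i u) cst S v.

Lemma init_sound T M : (forall u k, k < R -> M u k = set0) -> (forall u, M u R = [set u]) ->
  (forall u, T u R = c u) -> sound 0 T M.
Proof.
move=> M0 MR TR u uA; rewrite kids0; split.
  by move=> k kR; rewrite M0 // sub0set /costs !big_set0; split=> // v; rewrite inE.
by rewrite MR TR /costs big_set1 set11 sub1set mem_desc //; split=> // v; rewrite inE.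
Qed.

Lemma init_optimal T : (forall u k, k < R -> T u k = 0) -> (forall u, T u R = c u) ->
  optimal 0 T.
Proof.
by move=> T0 TR u S uA _; rewrite kids0 !big_set0 TR addn0; split=> // k kR _; rewrite T0.
Qed.

(* The row of [v] that is optimal when its load must not exceed [j]. *)
Definition best_row (T : V -> nat -> nat) v j :=
  if (wr v <= j) && (T v (j - wr v) <= T v R) then j - wr v else R.

Lemma best_row_le T v j : j < R -> best_row T v j <= R.
Proof. by rewrite /best_row; case: ifP => // _; lia. Qed.

Lemma row_sound i T M v j : rk v <= i -> v \in A -> sound i T M -> j < R ->
  let S := M v (best_row T v j) in
  [/\ S \subset desc A v, costs c S <= T v (best_row T v j), load S v <= j & light S v].
Proof.
move=> vi vA snd jR; have [s1 [vM sub cs l]] := snd v vA; rewrite kids_all // in l.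
rewrite /best_row; case: ifP => [/andP[wj _]|_] /=; last first.
  split=> //; first by rewrite load_del.
  by apply: light_parent => //; rewrite load_del //; lia.
have [|sub1 cs1] := s1 (j - wr v); first by lia.
rewrite kids_all // => ld1 l1; have ld : load (M v (j - wr v)) v <= j.
  have [vM'|vM'] := boolP (v \in M v (j - wr v)); first by rewrite load_del.
  by rewrite load_keep //; lia.
by split=> //; apply: light_parent => //; lia.
Qed.

Lemma row_optimal i T v j S : rk v <= i -> v \in A -> optimal i T -> j < R ->
  light S v -> load S v <= j -> T v (best_row T v j) <= cst S v.
Proof.
move=> vi vA opt jR lS ld; have [|o1 o2] := opt v S vA.
  by rewrite kids_all // => u uv; apply: light_child lS.
rewrite kids_all // in o1 o2; rewrite cst_children //.
have leR : T v (best_row T v j) <= T v R by rewrite /best_row; case: ifP => // /andP[].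
have [vS|vS] := boolP (v \in S); first by rewrite mul1n; apply: leq_trans leR o2.
rewrite load_keep // in ld; have := o1 (j - wr v); move=> /(_ ltac:(lia) ltac:(lia)) o.
apply: leq_trans o; rewrite /best_row.
by case: ifP => // /negbT; rewrite negb_and -ltnNge; lia.
Qed.

Lemma cst_sub v : v \in A -> cst A v <= costs c A.
Proof.
move=> vA; rewrite /costs /cst [leqLHS]big_mkcond [leqRHS]big_mkcond.
apply: leq_sum => x _; case: ifP => // /(subsetP (desc_sub _ _ _)) ->.
by rewrite mul1n.
Qed.

Lemma load_all v : load A v = 0.
Proof. by rewrite /load setDv desc_out ?big_set0 // inE. Qed.

Lemma light_all v : 0 < R -> light A v.
Proof. by move=> R0; apply/forall_inP => x _; rewrite load_all. Qed.

(* Deleting everything is always allowed; comparing with it keeps the entries of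
   the tables within a machine word. *)
Lemma merge_le T v p k j : 0 < R -> v \in A -> p \in A -> par v = Some p ->
  optimal (rk v) T -> k <= R -> j < R ->
  T p k + T v (best_row T v j) <= costs c A.
Proof.
move=> R0 vA pA pv opt kR jR; apply: leq_trans (cst_sub pA).
rewrite cst_children // pA mul1n.
have vk : v \notin kids (rk v) p by rewrite inE ltnn andbF.
have kv : v \in children A p by rewrite inE vA pv eqxx.
have sub : T p k <= c p + \sum_(u in kids (rk v) p) cst A u.
  have [|o1 o2] := opt p A pA; first by move=> u _; apply: light_all.
  move: kR; rewrite leq_eqVlt => /predU1P[->//|kR]; apply: leq_trans (o1 k kR _) _.
    by rewrite big1 // => u _; apply: load_all.
  exact: leq_addl.
have row : T v (best_row T v j) <= cst A v.
  by apply: row_optimal opt _ _ _ => //; [apply: light_all | rewrite load_all].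
apply: leq_trans (leq_add sub row) _; rewrite -addnA leq_add2l addnC.
rewrite -(big_setU1 _ vk) /=; rewrite [leqLHS]big_mkcond [leqRHS]big_mkcond.
apply: leq_sum => u _; case: ifP => // ; rewrite in_setU1 => /predU1P[->|]; first by rewrite kv.
by rewrite inE => /andP[->].
Qed.

(** One knapsack step: a load [k] allowed on the children of [p] is split into [j] for [v] and
    [k - j] for the earlier ones. In row [R] the vertex [p] is deleted, so loads do not add up and
    [v] may use the largest one, [R.-1]. *)
Definition merged (T T' : V -> nat -> nat) (M M' : V -> nat -> {set V}) v p :=
  [/\ forall k, k < R -> exists j, [/\ j <= k,
        T' p k = T p (k - j) + T v (best_row T v j),
        M' p k = M p (k - j) :|: M v (best_row T v j) &
        forall j, j <= k -> T' p k <= T p (k - j) + T v (best_row T v j)],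
      T' p R = T p R + T v (best_row T v R.-1),
      M' p R = M p R :|: M v (best_row T v R.-1) &
      forall u k, k <= R -> u != p -> T' u k = T u k /\ M' u k = M u k].

Lemma costsU S S' : costs c (S :|: S') <= costs c S + costs c S'.
Proof.
rewrite /costs [leqLHS]big_mkcond [X in _ <= X + _]big_mkcond [X in _ <= _ + X]big_mkcond.
rewrite -big_split; apply: leq_sum => x _; rewrite in_setU.
by do !case: (x \in _) => //=; rewrite ?leq_addr.
Qed.

(** Enlarging a selection only lowers the loads, and costs are subadditive; this settles the union
    of the two selections. *)
Lemma merge_sound T T' M M' v p : 0 < R -> v \in A -> p \in A -> par v = Some p ->
  sound (rk v) T M -> merged T T' M M' v p -> sound (rk v).+1 T' M'.
Proof.
move=> R0 vA pA pv snd [mk mTR mMR mo] u uA.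
rewrite kidsS vA pv /=; have [E|ne] := eqVneq u p; last first.
  have -> : (Some p == Some u) = false by apply: contraNF ne => /eqP[->].
  have [s1 s2] := snd u uA; split.
    by move=> k kR; have [-> ->] := mo u k (ltnW kR) ne; apply: s1.
  by have [-> ->] := mo u R (leqnn R) ne.
rewrite {u uA}E eqxx; have [s1 [pM sub cs l]] := snd p pA.
have vk : v \notin kids (rk v) p by rewrite inE ltnn andbF.
have dv : desc A v \subset desc A p by apply: desc_child => //; rewrite inE vA pv eqxx.
split=> [k kR|].
  have [j [jk -> -> _]] := mk k kR; have jR : j < R by lia.
  have [|sub1 cs1 ld1 l1] := s1 (k - j); first by lia.
  have [sub2 cs2 ld2 l2] := row_sound (leqnn _) vA snd jR; split.
  - by rewrite subUset sub1 (subset_trans sub2).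
  - by apply: leq_trans (costsU _ _) (leq_add cs1 cs2).
  - rewrite big_setU1 //= -(subnKC jk); apply: leq_add.
      by apply: leq_trans ld2; apply: load_anti; apply: subsetUr.
    rewrite (subnKC jk); apply: leq_trans ld1.
    by apply: leq_sum => x _; apply: load_anti; apply: subsetUl.
  - move=> x; rewrite in_setU1 => /predU1P[->|/l1 lx].
      by apply: light_anti l2; apply: subsetUr.
    by apply: light_anti lx; apply: subsetUl.
have [|sub2 cs2 ld2 l2] := row_sound (leqnn _) vA snd (_ : R.-1 < R); first by lia.
rewrite mTR mMR; split; rewrite ?inE ?pM //.
- by rewrite subUset sub (subset_trans sub2).
- by apply: leq_trans (costsU _ _) (leq_add cs cs2).
- move=> x; rewrite in_setU1 => /predU1P[->|/l lx].
    by apply: light_anti l2; apply: subsetUr.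
  by apply: light_anti lx; apply: subsetUl.
Qed.

Lemma merge_optimal T T' M M' v p : 0 < R -> v \in A -> p \in A -> par v = Some p ->
  optimal (rk v) T -> merged T T' M M' v p -> optimal (rk v).+1 T'.
Proof.
move=> R0 vA pA pv opt [mk mTR _ mo] u S uA.
rewrite kidsS vA pv /=; have [E|ne] := eqVneq u p; last first.
  have -> : (Some p == Some u) = false by apply: contraNF ne => /eqP[->].
  move=> /(opt u S uA)[o1 o2]; split; last by have [-> _] := mo u R (leqnn R) ne.
  by move=> k kR; have [-> _] := mo u k (ltnW kR) ne; apply: o1.
rewrite {u uA}E eqxx => l.
have vk : v \notin kids (rk v) p by rewrite inE ltnn andbF.
have [|o1 o2] := opt p S pA; first by move=> x xk; apply: l; rewrite in_setU1 xk orbT.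
have lv : light S v by apply: l; rewrite setU11.
rewrite !big_setU1 //=; split=> [k kR ld|]; last first.
  rewrite mTR addnCA addnC; apply: leq_add o2; apply: row_optimal opt _ _ _ => //; first by lia.
  by have := light_load vA lv; lia.
(* The competitor dictates the split: the share of [v] is its load under [S]. *)
have [j0 [_ _ _ /(_ (load S v))]] := mk k kR; move=> /(_ ltac:(lia)) m.
apply: leq_trans m _; rewrite addnC; apply: leq_add; first by apply: row_optimal opt _ _ _ => //; lia.
by apply: o1; lia.
Qed.

Lemma skip_sound T M v : (forall p, p \in A -> v \in A -> par v != Some p) ->
  (sound (rk v) T M -> sound (rk v).+1 T M) /\ (optimal (rk v) T -> optimal (rk v).+1 T).
Proof.
move=> np.
have E u : u \in A -> kids (rk v).+1 u = kids (rk v) u.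
  by move=> uA; rewrite kidsS; case: ifP => // /andP[vA pu]; have := np u uA vA; rewrite pu.
by split=> h u; [move=> uA | move=> S uA]; rewrite E //; apply: h.
Qed.

End Knapsack.

(** * Rounding the weights *)

Section Rounding.
Variables (V : finType) (e : rel V) (par : V -> option V) (rk : V -> nat).
Hypothesis rk_par : forall x y, par x = Some y -> rk x < rk y.
Hypothesis e_par : forall x y, e x y = (par x == Some y) || (par y == Some x).
Hypothesis rk_inj : injective rk.
Variables (c w : V -> nat) (n K : nat).
Hypotheses (n_gt0 : 0 < n) (V_le : #|V| <= n) (K_gt1 : 1 < K).
Implicit Types (A S C : {set V}).

(** The unit is W / (2 n K), so that n K units stand for W / 2. For W = 0, division by 0 makes all
    rounded weights 0. *)
Definition rounded W v := w v * (2 * (n * K)) %/ W.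

Lemma rounded_le W C : 2 * weight w C <= W -> \sum_(x in C) rounded W x <= n * K.
Proof.
case: W => [|W] wC; first by rewrite big1 // => x _; rewrite /rounded divn0.
rewrite -(leq_pmul2r (ltn0Sn W)) big_distrl /=.
apply: (@leq_trans (\sum_(x in C) w x * (2 * (n * K)))).
  by apply: leq_sum => x _; apply: leq_divM.
by rewrite -big_distrl /= -/(weight w C); nia.
Qed.

(** Rounding loses less than one unit per vertex, hence at most n units, that is, W / (2 K). The
    hypothesis [weight w C <= W] settles the case W = 0. *)
Lemma rounded_ge W C : weight w C <= W -> \sum_(x in C) rounded W x <= n * K ->
  2 * K * weight w C <= K.+1 * W.
Proof.
move=> wCW le; case: (posnP W) => [W0|W0]; first by move: wCW; rewrite W0 leqn0 => /eqP ->; rewrite muln0.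
have : weight w C * (2 * (n * K)) <= (\sum_(x in C) rounded W x + #|C|) * W.
  rewrite /weight big_distrl /= -sum1_card -big_split big_distrl /=.
  by apply: leq_sum => x _; rewrite /= addn1 ltnW // ltn_ceil.
have Cn : #|C| <= n := leq_trans (max_card _) V_le.
move=> le2; rewrite -(leq_pmul2l n_gt0).
have : (\sum_(x in C) rounded W x + #|C|) * W <= (n * K + n) * W.
  by rewrite leq_mul2r leq_add ?orbT.
nia.
Qed.

Variables (A : {set V}) (t : V).
Hypothesis t_top : is_top par A t.
Let H := desc par A t.
Let W := weight w H.
Let R := (n * K).+1.

(** If W = 0, the knapsack may select nothing, so [t] is added; this is free, as the cost clause of
    [phase_ok] carries the factor W. If W > 0, an empty selection would leave a part of weight W,
    contradicting 2 K W <= (K + 1) W for K > 1. *)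
Lemma phase_knapsack i T M l :
  rk t <= i -> sound par rk A c (rounded W) R i T M -> optimal par rk A c (rounded W) R i T ->
  uniq l -> 
  (forall x, x \in l =
    (x \in M t (best_row (rounded W) R T t R.-1)) || (W == 0) && (x == t)) ->
  phase_ok e c w K A (H, l) /\ l != [::].
Proof.
move=> ti snd opt ul lE; have [tA _] := andP t_top.
have [S_sub S_cost S_load S_light] := row_sound rk_par ti tA snd (ltnSn R.-1).
set S := M t _ in lE S_sub S_cost S_load S_light.
have HC : comp e A t = H by rewrite (top_desc e_par t_top) //; apply: mem_desc.
have lH x : x \in l -> x \in H.
  by rewrite lE => /orP[/(subsetP S_sub)|/andP[_ /eqP ->]] //; apply: mem_desc.
(* The part containing [v] is the subtree of its top [t'], so its rounded weight is a load, at most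
   n K. *)
have sepS v : v \in H -> v \notin l -> 2 * K * weight w (comp e (A :\: [set s in l]) v) <= K.+1 * W.
  move=> vH vl; have vAl : v \in A :\: [set s in l].
    by rewrite !inE vl (subsetP (desc_sub _ _ _) _ vH).
  have [t' top' vt'] := exists_top rk_par vAl.
  rewrite (top_desc e_par top' vt').
  have t'H : t' \in H.
    rewrite -HC; have <- : comp e A v = comp e A t.
      by apply: (comp_eq (forest_sym e_par)); rewrite HC.
    apply: (subsetP (comp_mono e v (subsetDl A [set s in l]))).
    by rewrite (top_desc e_par top' vt'); apply: mem_desc; case/andP: top'.
  apply: rounded_ge.
    apply: weight_sub; rewrite -HC; have <- : comp e A v = comp e A t.
      by apply: (comp_eq (forest_sym e_par)); rewrite HC.
    rewrite -(top_desc e_par top' vt'); apply: comp_mono; apply: subsetDl.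
  have /forall_inP/(_ t' t'H) : light par A (rounded W) R [set s in l] t.
    apply: light_anti S_light; apply/subsetP => x xS; rewrite inE lE xS //.
  by rewrite ltnS.
split; last first.
  apply/eqP => l0; rewrite l0 in lE sepS.
  have := lE t; rewrite eqxx andbT in_nil => /esym/norP[_ W0].
  have tH : t \in H by apply: mem_desc.
  have := sepS t tH isT; have -> : A :\: [set s in [::]] = A by apply/setP => x; rewrite !inE.
  by rewrite HC -/W; move: W0; rewrite -lt0n; nia.
split=> //=; first by exists t.
move=> S' S'H sep'; rewrite -/W; have [->|W0] := posnP W; first by rewrite !mul0n.
rewrite leq_mul2l; apply/orP; right.
have -> : \sum_(s <- l) c s = costs c S.
  rewrite big_uniq //; apply: eq_bigl => x.
  by rewrite lE (gtn_eqF W0) /= orbF.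
(* The loads under [S'] are rounded weights of connected sets avoiding [S'], to which the assumption
   on [S'] applies. *)
have l' : light par A (rounded W) R S' t.
  apply/forall_inP => x xH; rewrite ltnS; apply: rounded_le.
  set D := desc par _ x.
  have [D0|D0] := eqVneq D set0; first by rewrite D0 /weight big_set0.
  apply: sep' => //; first exact: (desc_connected e_par).
  apply/subsetP => y; rewrite !inE => /and3P[/andP[-> yA] xAS cyx] /=.
  move: xH; rewrite inE yA => /and3P[_ -> cxt] /=; apply: connect_trans cxt.
  apply: connect_sub cyx => a b /and3P[/setDP[aA _] /setDP[bA _] ab].
  by apply: connect1; rewrite upE aA bA.
apply: leq_trans S_cost _; apply: (leq_trans (row_optimal rk_par ti tA opt _ l' _)) => //.
  exact: (light_load tA l').
rewrite /cst /costs -/H [leqLHS]big_mkcond [leqRHS]big_mkcond.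
by apply: leq_sum => x _; case: (x \in H); case: (x \in S'); rewrite /= ?mul1n ?mul0n.
Qed.

End Rounding.

(** * Structured programs and their verification *)

(** Evaluation without the overflow check; [eval_ev] shows that it agrees with [eval] on bounded
    stores. *)
Fixpoint ev (s : store) (x : expr) : nat :=
  match x with
  | Const v => v
  | Read a y => s a (ev s y)
  | Op o y z => binop_sem o (ev s y) (ev s z)
  end.

(* The flag of [PFor] selects the loop bound: cell 0 of array 5, which will hold
   the number R of rows of a table, or cell 0 of array 0, which holds n. *)
Inductive prog :=
| PWrite of nat & expr & expr
| PSeq of prog & prog
| PIf of expr & prog & prog
| PSkip
| PFor of nat & bool & prog.

Notation get a := (Read a (Const 0)).
Notation set_reg a x := (PWrite a (Const 0) x).

Definition loop_size (b : bool) : expr := if b then get 5 else get 0.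

Definition loop_test (i : nat) (b : bool) : expr :=
  Op Leq (Op Add (get i) (Const 1)) (loop_size b).

Fixpoint compile (p : prog) : cmd :=
  match p with
  | PSkip => Skip
  | PWrite a x y => Write a x y
  | PSeq p q => Seq (compile p) (compile q)
  | PIf x p q => If x (compile p) (compile q)
  | PFor i b p =>
      Seq (Write i (Const 0) (Const 0))
          (While (loop_test i b)
             (Seq (compile p) (Write i (Const 0) (Op Add (get i) (Const 1)))))
  end.

Fixpoint writes (p : prog) : seq nat :=
  match p with
  | PSkip => [::]
  | PWrite a _ _ => [:: a]
  | PSeq p q => writes p ++ writes q
  | PIf _ p q => writes p ++ writes q
  | PFor i _ p => i :: writes p
  end.

Section Logic.
Variables (n R : nat).

(** A loop iteration has an overhead of 14: 8 for the test and 6 for the increment. The 11 is 3 for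
    the initialisation plus 8 for the last test. A conditional is charged for both branches. *)
Fixpoint ptime (p : prog) : nat :=
  match p with
  | PSkip => 1
  | PWrite _ x y => (expr_time x + expr_time y).+1
  | PSeq p q => ptime p + ptime q
  | PIf x p q => (expr_time x).+1 + (ptime p + ptime q)
  | PFor _ b p => (if b then R else n) * (ptime p + 14) + 11
  end.

(* Overflow is excluded by an invariant: the cells of array [a] never exceed
   [X ^ d a].  [vexp] and [eexp] bound the value, resp. all the intermediate
   values, of an expression by a power of [X] found by computation. *)
Variables (X B kk : nat) (d : nat -> nat).
Hypothesis X2 : 2 <= X.
Hypothesis XB : X ^ kk <= B.

Fixpoint vexp (x : expr) : nat :=
  match x with
  | Const v => v.-1
  | Read a _ => d a
  | Op Add y z => (maxn (vexp y) (vexp z)).+1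
  | Op Defs.Sub y _ | Op Div y _ => vexp y
  | Op Mul y z => vexp y + vexp z
  | Op Leq _ _ => 0
  end.

Fixpoint eexp (x : expr) : nat :=
  maxn (vexp x)
  match x with
  | Const v => 0
  | Read _ y => eexp y
  | Op _ y z => maxn (eexp y) (eexp z)
  end.

Definition bounded (s : store) := forall a j, s a j <= X ^ d a.

Lemma X_gt0 : 0 < X. Proof using X2. exact: ltnW. Qed.

Lemma leq_pexp m k : m <= k -> X ^ m <= X ^ k.
Proof using X2. exact: leq_pexp2l X_gt0. Qed.

Lemma vexp_le s x : bounded s -> ev s x <= X ^ vexp x.
Proof using X2.
clear XB; move=> bs; elim: x => [v|a y IH|o y IHy z IHz] /=.
- apply: leq_trans (_ : 2 ^ v.-1 <= _).
    by case: v => // v; apply: ltn_expl.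
  by case: v => [|[|v]] //; rewrite leq_exp2r.
- exact: bs.
case: o => /=.
- have := leq_pexp (leq_maxl (vexp y) (vexp z)).
  have := leq_pexp (leq_maxr (vexp y) (vexp z)).
  rewrite expnS; move: (X ^ maxn _ _) IHy IHz => m; nia.
- by lia.
- by rewrite expnD leq_mul.
- exact: leq_trans (leq_div _ _) IHy.
- by rewrite expn0 leq_b1.
Qed.

Lemma eval_ev s x : bounded s -> eexp x <= kk -> eval B s x = Some (ev s x).
Proof.
have wordE v y : bounded s -> vexp y <= kk -> v = ev s y -> word B v = Some v.
  move=> bs le ->; rewrite /word ifT //.
  exact: leq_trans (vexp_le _ bs) (leq_trans (leq_pexp le) XB).
move=> bs; elim: x => [v|a y IH|o y IHy z IHz] /=.
- by rewrite geq_max => /andP[le _]; apply: (wordE _ (Const v)).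
- rewrite geq_max => /andP[le /IH ->] /=.
  by apply: (wordE _ (Read a y)).
- rewrite !geq_max => /and3P[le /IHy -> /IHz ->] /=.
  exact: (wordE _ (Op o y z)).
Qed.

(** Side conditions decided by computation on a concrete program: no word overflows during
    evaluation, and a loop body writes neither its counter nor the arrays holding the loop
    bounds. *)
Fixpoint pexp (p : prog) : bool :=
  match p with
  | PSkip => true
  | PWrite a x y => (eexp x <= kk) && (eexp y <= kk)
  | PSeq p q => pexp p && pexp q
  | PIf x p q => [&& eexp x <= kk, pexp p & pexp q]
  | PFor i b p => [&& (if b then d 5 else d 0) <= d i, i \notin [:: 0; 5],
       i \notin writes p, 0 \notin writes p, 5 \notin writes p,
       eexp (loop_test i b) <= kk & pexp p]
  end.

Definition frame (p : prog) (s s' : store) :=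
  forall a j, a \notin writes p -> s' a j = s a j.

Definition env (s : store) := [/\ bounded s, s 0 0 = n & s 5 0 = R].

Lemma env_frame p s s' : env s -> bounded s' -> frame p s s' ->
  0 \notin writes p -> 5 \notin writes p -> env s'.
Proof. by move=> [_ s0 s5] bs fr w0 w5; split; rewrite ?fr. Qed.

(** Total correctness within the time bound. Boundedness and the frame property are built in, so
    that specifications need only mention what changes. *)
Definition wp (p : prog) (Q : store -> Prop) (s : store) : Prop :=
  exists t s', [/\ exec B (compile p) s t s', t <= ptime p, bounded s',
                   frame p s s' & Q s'].

Lemma wp_conseq p (Q Q' : store -> Prop) s :
  wp p Q s -> (forall s', bounded s' -> frame p s s' -> Q s' -> Q' s') -> wp p Q' s.
Proof. by move=> [t [s' [? ? ? ? q]]] H; exists t, s'; split=> //; apply: H. Qed.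

Lemma wp_skip (Q : store -> Prop) s : bounded s -> Q s -> wp PSkip Q s.
Proof. by move=> bs q; exists 1, s; split=> //; exact: ExecSkip. Qed.

Lemma bounded_update s a i v :
  bounded s -> v <= X ^ d a -> bounded (update s a i v).
Proof. by move=> bs le b j; rewrite /update; case: eqP => [->|] //=; case: eqP. Qed.

Lemma wp_write a x y (Q : store -> Prop) s :
  bounded s -> pexp (PWrite a x y) -> ev s y <= X ^ d a ->
  (bounded (update s a (ev s x) (ev s y)) -> Q (update s a (ev s x) (ev s y))) ->
  wp (PWrite a x y) Q s.
Proof.
move=> bs /= /andP[ex ey] le q; have bs' := bounded_update (ev s x) bs le.
exists (expr_time x + expr_time y).+1, (update s a (ev s x) (ev s y)).
split=> //; [by apply: ExecWrite; apply: eval_ev| |exact: q].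
by move=> b j; rewrite inE /update => /negbTE ->.
Qed.

Lemma static_le s y m : bounded s -> vexp y <= m -> ev s y <= X ^ m.
Proof using X2. by move=> bs /leq_pexp; apply: leq_trans (vexp_le y bs). Qed.

Lemma wp_seq p q (Q : store -> Prop) s : wp p (wp q Q) s -> wp (PSeq p q) Q s.
Proof.
move=> [t [s' [e1 t1 b1 f1 [t' [s2 [e2 t2 b2 f2 h]]]]]].
exists (t + t'), s2; split=> //=; first exact: ExecSeq e1 e2.
  exact: leq_add.
by move=> a j /=; rewrite mem_cat negb_or => /andP[? ?]; rewrite f2 ?f1.
Qed.

Lemma wp_if x p q (Q : store -> Prop) s :
  bounded s -> eexp x <= kk -> (ev s x != 0 -> wp p Q s) ->
  (ev s x = 0 -> wp q Q s) -> wp (PIf x p q) Q s.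
Proof.
move=> bs ex hp hq; have evx := eval_ev bs ex.
have [x0|x0] := boolP (ev s x != 0).
  have [t [s' [e1 t1 b1 f1 h]]] := hp x0.
  exists ((expr_time x).+1 + t), s'; split=> //=.
  - by apply: ExecIf evx _; rewrite x0.
  - by lia.
  - by move=> a j; rewrite mem_cat negb_or => /andP[? ?]; rewrite f1.
have [t [s' [e1 t1 b1 f1 h]]] := hq (eqP (negPn x0)).
exists ((expr_time x).+1 + t), s'; split=> //=.
- by apply: ExecIf evx _; rewrite (negbTE x0).
- by lia.
- by move=> a j; rewrite mem_cat negb_or => /andP[? ?]; rewrite f1.
Qed.

(** [I k] is asserted when the counter already holds [k], whence the updates in the premises. The
    frame relative to the start of the loop is provided at each iteration and need not be put into
    [I]. *)
Lemma wp_for i b p (I : nat -> store -> Prop) (Q : store -> Prop) s :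
  env s -> pexp (PFor i b p) -> 
  I 0 (update s i 0 0) ->
  (forall k s1, k < (if b then R else n) -> env s1 -> s1 i 0 = k ->
     frame (PFor i b p) s s1 -> I k s1 ->
     wp p (fun s2 => I k.+1 (update s2 i 0 k.+1)) s1) ->
  (forall s1, bounded s1 -> frame (PFor i b p) s s1 ->
     I (if b then R else n) s1 -> Q s1) ->
  wp (PFor i b p) Q s.
Proof.
move=> [bs sn sR] px I0 step fin.
set N := if b then R else n in step fin *.
move: (px) => /= /and5P[dib i05 iw w0 /and3P[w5 et pe]].
have sN s1 : s1 0 0 = n -> s1 5 0 = R -> ev s1 (loop_size b) = N.
  by rewrite /N; case: (b).
have Ndi : N <= X ^ d i.
  by apply: leq_trans (leq_pexp dib); rewrite /N; case: (b); rewrite -?sn -?sR.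
move: i05; rewrite !inE negb_or => /andP[i0 i5].
have fr0 s1 : frame (PFor i b p) s s1 -> s1 0 0 = n /\ s1 5 0 = R.
  move=> fr; rewrite -sn -sR; split; apply: fr; rewrite /= inE negb_or.
    by rewrite eq_sym i0.
  by rewrite eq_sym i5.
have loop m : forall k s1, k + m = N -> bounded s1 -> frame (PFor i b p) s s1 ->
    s1 i 0 = k -> I k s1 ->
    exists t s2, [/\ exec B (While (loop_test i b)
      (Seq (compile p) (Write i (Const 0) (Op Add (get i) (Const 1))))) s1 t s2,
      t <= m * (ptime p + 14) + 8, bounded s2, frame (PFor i b p) s s2 & I N s2].
  elim: m => [|m IHm] k s1 kN bs1 fr s1i Ik.
    have [s10 s15] := fr0 _ fr.
    exists (expr_time (loop_test i b)).+1, s1; split=> //.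
    - apply: ExecWhileEnd; rewrite eval_ev //; congr Some.
      by change ((s1 i 0 + 1 <= ev s1 (loop_size b)) = 0 :> nat); rewrite s1i sN //; lia.
    - by case: (b).
    - by rewrite -kN addn0.
  have [s10 s15] := fr0 _ fr.
  have kltN : k < N by lia.
  have [t [s2 [ex2 t2 bs2 fr2 I2]]] := step k s1 kltN (And3 bs1 s10 s15) s1i fr Ik.
  have s2i : s2 i 0 = k by rewrite fr2.
  have bs3 : bounded (update s2 i 0 k.+1).
    by apply: bounded_update => //; apply: leq_trans Ndi.
  have fr3 : frame (PFor i b p) s (update s2 i 0 k.+1).
    move=> a j ha; rewrite -(fr a j ha); move: ha; rewrite /= inE negb_or => /andP[ai ap].
    by rewrite /update (negbTE ai) /= fr2.
  have [||t' [s4 [ex4 t4 bs4 fr4 I4]]] := IHm k.+1 _ _ bs3 fr3 _ I2; first by lia.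
    by rewrite /update !eqxx.
  have e1 : eval B s1 (loop_test i b) = Some 1.
    rewrite eval_ev //; congr Some.
    by change ((s1 i 0 + 1 <= ev s1 (loop_size b)) = 1 :> nat); rewrite s1i sN //; lia.
  have e2 : eval B s2 (Op Add (get i) (Const 1)) = Some k.+1.
    rewrite eval_ev //=; first by rewrite s2i addn1.
    apply: leq_trans et; rewrite [X in _ <= X]/= -/(eexp _) leq_max; apply/orP; right.
    by rewrite leq_max leqnn.
  have := ExecWhileLoop e1 (ExecSeq ex2 (ExecWrite i (erefl : eval B s2 (Const 0) = Some 0) e2)) ex4.
  move=> ex; exists ((expr_time (loop_test i b)).+1 + (t + (expr_time (Const 0) +
      expr_time (Op Add (get i) (Const 1))).+1) + t'), s4; split=> //.
  by move: t2 t4; rewrite /loop_test mulSn; case: (b) => /=; lia.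
have [||||t [s2 [ex2 t2 bs2 fr2 I2]]] := loop N 0 (update s i 0 0) _ _ _ _ I0 => //.
- exact: bounded_update.
- by move=> a j; rewrite /= inE negb_or /update => /andP[/negbTE -> _].
- by rewrite /update !eqxx.
exists (3 + t), s2; split=> //.
- by apply: ExecSeq ex2; apply: ExecWrite.
- by rewrite /= -/N; lia.
- exact: fin.
Qed.

End Logic.

Arguments wp_write {n R X B kk d}.
Arguments wp_skip {n R X B d}.

(** * The program: elimination order *)

Notation add := (Op Add).
Notation sub := (Op Defs.Sub).
Notation mul := (Op Mul).
Notation quo := (Op Div).
Notation le := (Op Leq).
Notation eqe x y := (mul (le x y) (le y x)).
Infix ";;" := PSeq (at level 60, right associativity).

(* Arrays 0 to 4 hold the input and the output, array 5 holds R.  In the others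
   the vertex [v] is denoted by [v + 1], and 0 stands for "none", so that a
   missing parent passes for a vertex that is not alive:
   6 indicator of the vertices not queried yet ("alive"); 7 parent in the forest;
   8 elimination order; 9 top of the component; 10, 11 costs and masks of the
   rows of the tables; 12 best row for each load; 13 weight of the component;
   14 its top; 15-18, 23, 24, 26, 32, 33 loop variables; 19 degree; 20 neighbour;
   21, 22 leaf found and its neighbour; 25 best split; 27 rounded weight;
   28, 34 current parent and vertex; 29-31 target and sources of a row update.
   The entries of [dexp] bound the cells in the sense of [bounded]. *)
Definition dexp (a : nat) : nat :=
  nth 1 [:: 1; 0; 1; 1; 2; 5; 0; 2; 2; 1; 2; 0; 5; 2; 2;
            1; 1; 1; 1; 1; 2; 2; 2; 5; 5; 5; 1; 7; 2; 10; 10; 10; 1; 5; 2] a.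
(** An exponent dominating [eexp] on all expressions of the program; it is also the word size factor
    [k] in the theorem. *)
Definition kexp := 60.

Definition p_alive := PFor 17 false (PWrite 6 (add (get 17) (Const 1)) (Const 1)).

Definition p_scan_u :=
  PFor 18 false
    (PIf (mul (Read 1 (add (mul (get 17) (get 0)) (get 18))) (Read 6 (add (get 18) (Const 1))))
       (set_reg 19 (add (get 19) (Const 1)) ;; set_reg 20 (add (get 18) (Const 1)))
       PSkip).

Definition p_scan_v :=
  PFor 17 false
    (set_reg 19 (Const 0) ;; set_reg 20 (Const 0) ;; p_scan_u ;;
     PIf (mul (Read 6 (add (get 17) (Const 1))) (le (get 19) (Const 1)))
       (set_reg 21 (add (get 17) (Const 1)) ;; set_reg 22 (get 20))
       PSkip).

(** Leaves are stripped one by one, the remaining neighbour becoming the parent, so parents come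
    later in the order. The naive search takes O(n^3) steps in all, within the time allowed. *)
Definition p_elim :=
  PFor 16 false
    (p_scan_v ;; PWrite 8 (get 16) (get 21) ;; PWrite 7 (get 21) (get 22) ;;
     PWrite 6 (get 21) (Const 0)).

Definition code n (o : option 'I_n) : nat := if o is Some u then u.+1 else 0.

Lemma prefixS n (D : {set 'I_n}) (v : 'I_n) : [set x in D | x < v.+1] =
  if v \in D then v |: [set x in D | x < v] else [set x in D | x < v].
Proof.
apply/setP => x; rewrite (fun_if (fun C : {set 'I_n} => x \in C)) !inE ltnS leq_eqVlt.
rewrite -[x == v :> nat]/(x == v); case: (eqVneq x v) => [->|_] /=; last by case: ifP.
by rewrite ltnn !andbF andbT; case: ifP.
Qed.

Section Verification.
Variables (n R X B : nat) (e : rel 'I_n) (c w : 'I_n -> nat).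
Hypotheses (X2 : 2 <= X) (XB : X ^ kexp <= B) (nX : n <= X).
Hypothesis e_tree : is_tree e.

Local Notation wp := (wp n R X B dexp).
Local Notation env := (env n R X dexp).
Local Notation bounded := (bounded X dexp).

(** For writes whose bound needs a semantic argument; [wp_set] takes the bound from [vexp]
    instead. *)
Lemma wp_put a x y i v (Q : store -> Prop) s : bounded s -> pexp kexp dexp (PWrite a x y) ->
  ev s x = i -> ev s y = v -> v <= X ^ dexp a ->
  (bounded (update s a i v) -> Q (update s a i v)) -> wp (PWrite a x y) Q s.
Proof. by move=> bs px <- <- le q; apply: (wp_write X2 XB). Qed.

Lemma wp_set a x y i v (Q : store -> Prop) s : bounded s ->
  pexp kexp dexp (PWrite a x y) && (vexp dexp y <= dexp a) ->
  ev s x = i -> ev s y = v ->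
  (bounded (update s a i v) -> Q (update s a i v)) -> wp (PWrite a x y) Q s.
Proof.
move=> bs /andP[px le] Ex Ey; apply: wp_put => //; rewrite -Ey.
exact: (static_le X2).
Qed.

Definition inp (s : store) := [/\ env s, forall u v : 'I_n, s 1 (u * n + v) = e u v,
  forall v : 'I_n, s 2 v = c v & forall v : 'I_n, s 3 v = w v].

Lemma inp_frame p s s' : inp s -> bounded s' -> frame p s s' ->
  all (fun a => a \notin writes p) [:: 0; 1; 2; 3; 5] -> inp s'.
Proof.
move=> [es s1 s2 s3] bs fr /= /and5P[w0 w1 w2 w3 /andP[w5 _]].
by split; [exact: env_frame es bs fr _ _|move=> u v|move=> v|move=> v]; rewrite fr.
Qed.

Definition alive (s : store) (A : {set 'I_n}) :=
  s 6 0 = 0 /\ forall v : 'I_n, s 6 v.+1 = (v \in A).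

Ltac wwrite := apply: (wp_write X2 XB); [done | done | try by apply: (static_le X2) | ].

Lemma env_upd s a i v : env s -> bounded (update s a i v) -> a \notin [:: 0; 5] ->
  env (update s a i v).
Proof.
move=> [_ s0 s5] bs; rewrite !inE negb_or => /andP[a0 a5].
by split=> //; rewrite /update eq_sym ?(negbTE a0) ?[5 == a]eq_sym ?(negbTE a5).
Qed.

Lemma inp_upd s a i v : inp s -> bounded (update s a i v) ->
  a \notin [:: 0; 1; 2; 3; 5] -> inp (update s a i v).
Proof.
move=> [es s1 s2 s3] bs; rewrite !inE !negb_or.
move=> /and5P[/negbTE a0 /negbTE a1 /negbTE a2 /negbTE a3 /negbTE a5].
split; first by apply: env_upd => //; rewrite !inE a0 a5.
- by move=> x y; rewrite /update [1 == a]eq_sym a1 /=.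
- by move=> x; rewrite /update [2 == a]eq_sym a2 /=.
- by move=> x; rewrite /update [3 == a]eq_sym a3 /=.
Qed.

Lemma alive_spec s : env s -> s 6 0 = 0 -> wp p_alive (fun s' => alive s' setT) s.
Proof.
move=> es s60.
apply: (wp_for X2 XB (I := fun k s1 => s1 6 0 = 0 /\ forall v, v < k -> s1 6 v.+1 = 1)) => //.
- move=> k s1 kn [bs _ _] s1k _ [I0 I1]; wwrite.
  move=> _; split=> [|v]; rewrite /= s1k addn1 /update /=; first by [].
  by rewrite ltnS leq_eqVlt eqSS; case: eqP => //= _ /I1.
- by move=> s1 _ _ [I0 I1]; split=> // v; rewrite inE I1.
Qed.

Definition leaf_code (A : {set 'I_n}) (v : 'I_n) (m : nat) :=
  exists o, [/\ m = code o, forall u, u \in A -> e v u = (o == Some u) &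
                forall u, o = Some u -> u \in A].

Lemma scan_u_spec s A (v : 'I_n) : inp s -> alive s A -> s 17 0 = v -> s 19 0 = 0 -> s 20 0 = 0 ->
  wp p_scan_u (fun s' => s' 19 0 = #|[set u in A | e v u]| /\
    (s' 19 0 <= 1 -> leaf_code A v (s' 20 0))) s.
Proof.
move=> is_ [al0 al] s17 s19 s20; have [es s1 s2 s3] := is_.
pose Ak k := [set u in A | e v u && (u < k)].
apply: (wp_for X2 XB (I := fun k s1 => s1 19 0 = #|Ak k| /\
   exists o, [/\ s1 20 0 = code o, (o = None -> Ak k = set0) & forall u, o = Some u -> u \in Ak k])) => //.
- split; first by rewrite /update /= s19; apply/esym/eqP; rewrite cards_eq0; apply/eqP/setP => u; rewrite !inE ltn0 !andbF.
  by exists None; split=> // _; apply/setP => u; rewrite !inE ltn0 !andbF.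
- move=> k s4 kn es4 s4k fr [Id [o [Io Io0 Io1]]].
  have is4 : inp s4 by apply: inp_frame is_ _ fr _ => //; case: es4.
  have [[bs4 _ _] adj _ _] := is4.
  pose u := Ordinal kn.
  have AkE j : Ak j = [set x in [set u in A | e v u] | x < j].
    by apply/setP => x; rewrite !inE andbA.
  have AkS : Ak k.+1 = if (u \in A) && e v u then u |: Ak k else Ak k.
    by rewrite !AkE (prefixS _ u) inE.
  have test : ev s4 (mul (Read 1 (add (mul (get 17) (get 0)) (get 18))) (Read 6 (add (get 18) (Const 1)))) = e v u * (u \in A).
    rewrite /= s4k addn1 (fr 6) // (fr 17) // s17 (al u); case: es4 => _ -> _.
    by rewrite (adj v u).
  apply: (wp_if X2 XB) => //; rewrite test => h.
    have {h} [uA evu] : (u \in A) /\ e v u by case: (u \in A) (e v u) h => -[].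
    rewrite uA evu in AkS.
    have uk : u \notin Ak k by rewrite !inE ltnn !andbF.
    apply: wp_seq; wwrite.
      (* The static bound of an increment exceeds the one of the register. But [u] has not been
         counted yet, so the new count is at most n. *)
      rewrite /= Id; apply: leq_trans (_ : n <= _); last by rewrite expn1.
      by rewrite -[n in _ <= n]card_ord -(cardsT 'I_n) addn1; apply: proper_card; rewrite properT; apply/eqP => /setP/(_ u); rewrite (negbTE uk) inE.
    move=> bs5; wwrite; move=> bs6; split.
      by rewrite AkS cardsU1 uk /update /= Id addnC.
    exists (Some u); rewrite AkS; split=> //; first by rewrite /update /= s4k addn1.
    by move=> _ [<-]; rewrite setU11.
  apply: wp_skip => //; have -> : Ak k.+1 = Ak k.
    by rewrite AkS andbC; move: h; case: (u \in A) (e v u) => -[].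
  by split=> //; exists o.
- move=> s4 bs4 fr [Id [o [Io Io0 Io1]]].
  have AkE : Ak n = [set u in A | e v u] by apply/setP => u; rewrite !inE ltn_ord andbT.
  rewrite AkE in Id Io0 Io1; split=> // le1; exists o; split=> //; last first.
    by move=> u /Io1; rewrite inE => /andP[].
  move=> u uA; case: o Io Io0 Io1 => [y|] Io Io0 Io1; last first.
    by have /setP/(_ u) := Io0 erefl; rewrite !inE uA.
  have yA := Io1 y erefl; rewrite Id in le1; have /cards1P[z zE] : #|[set u in A | e v u]| == 1.
    by rewrite eqn_leq le1 card_gt0; apply/set0Pn; exists y.
  rewrite zE in yA; have /setP/(_ u) := zE; rewrite !inE uA /= => ->.
  by move/set1P: yA => ->; rewrite eq_sym; apply/eqP/eqP => [->|[]].
Qed.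

Lemma alive_frame p s s' A : alive s A -> frame p s s' -> 6 \notin writes p -> alive s' A.
Proof. by move=> [a0 al] fr w6; split=> [|v]; rewrite fr. Qed.

Lemma scan_v_spec s A : inp s -> alive s A -> A != set0 ->
  wp p_scan_v (fun s' => exists2 v, v \in A & s' 21 0 = v.+1 /\ leaf_code A v (s' 22 0)) s.
Proof.
move=> is_ al A0; have [es _ _ _] := is_.
pose Q s' := exists2 v, v \in A & s' 21 0 = v.+1 /\ leaf_code A v (s' 22 0).
apply: (wp_for X2 XB (I := fun k s1 =>
   (exists v : 'I_n, [/\ v \in A, v < k & #|[set u in A | e v u]| <= 1]) -> Q s1)) => //.
- by move=> [v []].
- move=> k s1 kn es1 s1k fr I; have is1 : inp s1 by apply: inp_frame is_ _ fr _; case: es1.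
  have al1 : alive s1 A by apply: alive_frame al fr _.
  have [bs1 _ _] := es1; pose v := Ordinal kn.
  apply: wp_seq; wwrite => bs2; apply: wp_seq; wwrite => bs3; apply: wp_seq.
  apply: (wp_conseq (scan_u_spec (v := v) _ _ _ _ _)) => //.
  - exact: inp_upd (inp_upd is1 bs2 _) bs3 _.
  - by apply: al1.
  - move=> s4 bs4 fr4 [deg lf].
    have s17 : s4 17 0 = k by rewrite fr4.
    have s6 : s4 6 v.+1 = (v \in A) by rewrite fr4 // /update /= (al1.2 v).
    apply: (wp_if X2 XB) => // /=; rewrite s17 addn1 s6 => h.
      have {h} [vA le1] : v \in A /\ s4 19 0 <= 1.
        by move: h; case: (v \in A) (s4 19 0 <= 1) => -[].
      have {lf} lf := lf le1.
      apply: wp_seq; wwrite => bs5; wwrite => bs6 _; exists v => //; split=> //.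
      by rewrite /update /= s17 addn1.
    apply: wp_skip => // -[x [xA]]; rewrite ltnS leq_eqVlt => /predU1P[xk|xk] degx.
      have xv : x = v by apply: val_inj.
      by move: h; rewrite deg -xv xA degx.
    have [|y yA [y1 y2]] := I; first by exists x.
    by exists y => //; rewrite /update /= !fr4.
- move=> s1 _ _; apply; have [v vA v1] := tree_leaf e_tree A0.
  by exists v.
Qed.

(** A vertex outside [l] has index [size l], hence counts as later than all of [l]. The clauses thus
    also make sense for the partial orders met during the loop. *)
Definition order_spec (s : store) (l : seq 'I_n) :=
  [/\ uniq l, forall i : 'I_n, i < size l -> s 8 i = (nth i l i).+1 &
    forall x, x \in l -> exists o, [/\ s 7 x.+1 = code o,
       forall u, index x l < index u l -> e x u = (o == Some u) &
       forall u, o = Some u -> index x l < index u l]].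

Lemma elim_spec s : inp s -> alive s setT ->
  wp p_elim (fun s' => exists l, [/\ order_spec s' l, size l = n & s' 6 0 = 0]) s.
Proof.
move=> is_ al; have [es _ _ _] := is_.
apply: (wp_for X2 XB (I := fun k s1 => exists l,
   [/\ order_spec s1 l, size l = k & alive s1 (~: [set x in l])])) => //.
- exists [::]; split=> //; split.
    by case: al.
  by case: al => _ al v; rewrite /update /= al !inE.
- move=> k s1 kn es1 s1k fr [l [[ul ol pl] sl al1]].
  have is1 : inp s1 by apply: inp_frame is_ _ fr _; case: es1.
  have A0 : ~: [set x in l] != set0.
    apply/eqP => /(congr1 (fun C => #|~: C|)).
    by rewrite setCK setC0 cardsT card_ord cardsE (card_uniqP ul) sl; lia.
  apply: wp_seq; apply: (wp_conseq (scan_v_spec is1 al1 A0)) => s2 bs2 fr2 [v vA [cand [o [co eo oA]]]].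
  have vl : v \notin l by move: vA; rewrite !inE.
  apply: wp_seq; wwrite => bs3; apply: wp_seq; wwrite => bs4; wwrite => bs5.
  exists (rcons l v); rewrite size_rcons sl; split=> //; last first.
    case: al1 => a0 al1; split; first by rewrite /update /= cand fr2.
    move=> x; rewrite /update /= cand fr2 // eqSS al1 !inE mem_rcons inE negb_or.
    by rewrite -[x == v :> nat]/(x == v); case: eqP.
  split; first by rewrite rcons_uniq vl.
    move=> i; rewrite size_rcons ltnS leq_eqVlt nth_rcons /update /= fr2 // s1k cand -sl.
    case: eqP => [->|_ /= il]; first by rewrite ltnn.
    by rewrite il fr2 // ol.
  have idx x u : x \in l -> (index x (rcons l v) < index u (rcons l v)) = (index x l < index u l).
    move=> xl; rewrite -!cats1 !index_cat xl; case: ifP => // /negbT/memNindex ->.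
    by rewrite /= index_mem xl ltn_addr // index_mem.
  move=> x; rewrite mem_rcons inE => /predU1P[->|xl]; last first.
    have [ox [o1 o2 o3]] := pl x xl; exists ox; split.
    - have /negbTE xv : x != v by apply: contraNneq vl => <-.
      by rewrite /update /= cand eqSS [(x : nat) == v]xv /= fr2.
    - by move=> u; rewrite idx //; apply: o2.
    - by move=> u; rewrite idx //; apply: o3.
  have ilv u : (index v (rcons l v) < index u (rcons l v)) = (u \notin l) && (u != v).
    rewrite -!cats1 !index_cat (negbTE vl) /= eqxx addn0; case: ifP => ul'.
      by rewrite ltnNge ltnW // index_mem.
    by rewrite [u == v]eq_sym; case: (v == u) => /=; lia.
  exists o; split.
  - by rewrite /update /= cand eqxx co.
  - by move=> u; rewrite ilv => /andP[uln _]; apply: eo; rewrite !inE.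
  - move=> u ou; rewrite ilv; move: (oA u ou) (eo v vA); rewrite !inE ou => -> /=.
    by have [[_ irr _ _] _] := e_tree; rewrite irr => /esym/negbT; apply: contra => /eqP ->.
- by move=> s1 _ _ [l [os sl [s6 _]]]; exists l.
Qed.

End Verification.
Arguments wp_put {n R X B} X2 XB {a x y} i v {Q s}.
Arguments wp_set {n R X B} X2 XB {a x y} i v {Q s}.

Lemma order_par n (e : rel 'I_n) s l : is_tree e -> order_spec e s l -> size l = n ->
  exists par : 'I_n -> option 'I_n,
  [/\ forall x y : 'I_n, par x = Some y -> index x l < index y l,
      forall x y, e x y = (par x == Some y) || (par y == Some x) &
      forall x : 'I_n, s 7 x.+1 = code (par x)].
Proof.
move=> [[e_sym e_irr _ _] _] [ul _ pl] sl.
have inl x : x \in l.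
  have : size (enum 'I_n) <= size l by rewrite size_enum_ord sl.
  by move=> /(uniq_min_size ul (fun x _ => mem_enum 'I_n x))[_ ->]; rewrite ?mem_enum.
have [par parP] := fin_all_exists (fun x => pl x (inl x)).
exists par; split=> [x y|x y|x]; try by have [? ? ?] := parP x; auto.
have [_ ex px] := parP x; have [_ ey py] := parP y.
case: (ltngtP (index x l) (index y l)) => [lt|lt|E].
- rewrite (ex _ lt); case: (par y =P Some x) => [/py lt'|]; last by rewrite orbF.
  by move: (ltn_trans lt lt'); rewrite ltnn.
- rewrite e_sym (ey _ lt); case: (par x =P Some y) => // /px lt'.
  by move: (ltn_trans lt lt'); rewrite ltnn.
have <- : x = y by apply: index_inj E; rewrite ?inl.
by rewrite e_irr orbb; apply/esym/eqP => /px; rewrite ltnn.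
Qed.

(** * The program: tops of the components and their weights *)

Definition p_top :=
  set_reg 14 (Const 0) ;;
  PFor 16 false (PIf (Read 6 (Read 8 (get 16))) (set_reg 14 (Read 8 (get 16))) PSkip).

(** The order is run backwards, so that the top of the parent is known first. The sum is a
    branch-free choice between it and the vertex itself; a missing parent, coded 0, counts as not
    alive. *)
Definition p_tops :=
  PFor 16 false
    (set_reg 34 (Read 8 (sub (sub (get 0) (Const 1)) (get 16))) ;;
     set_reg 28 (Read 7 (get 34)) ;;
     PWrite 9 (get 34) (add (mul (Read 6 (get 28)) (Read 9 (get 28)))
                            (mul (sub (Const 1) (Read 6 (get 28))) (get 34)))).

Definition p_weight :=
  set_reg 13 (Const 0) ;;
  PFor 17 false
    (PIf (mul (Read 6 (add (get 17) (Const 1)))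
              (eqe (Read 9 (add (get 17) (Const 1))) (get 14)))
       (set_reg 13 (add (get 13) (Read 3 (get 17)))) PSkip).

Section Verification.
Variables (n R X B : nat) (e : rel 'I_n) (c w : 'I_n -> nat).
Hypotheses (X2 : 2 <= X) (XB : X ^ kexp <= B) (nX : n <= X).
Hypotheses (cX : forall v, c v <= X) (wX : forall v, w v <= X).
Variables (l : seq 'I_n) (par : 'I_n -> option 'I_n).
Hypotheses (l_uniq : uniq l) (l_size : size l = n).
Local Notation rk := (index^~ l).
Hypothesis rk_par : forall x y, par x = Some y -> rk x < rk y.
Hypothesis e_par : forall x y, e x y = (par x == Some y) || (par y == Some x).

Local Notation wp := (wp n R X B dexp).
Local Notation env := (env n R X dexp).
Local Notation bounded := (bounded X dexp).
Local Notation inp := (inp R X e c w).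
Local Notation desc := (desc par).
Implicit Types (A : {set 'I_n}).

Ltac wwrite := apply: (wp_write X2 XB); [done | done | try by apply: (static_le X2) | ].

Lemma mem_l x : x \in l.
Proof.
have : size (enum 'I_n) <= size l by rewrite size_enum_ord l_size.
by move=> /(uniq_min_size l_uniq (fun x _ => mem_enum 'I_n x))[_ ->]; rewrite ?mem_enum.
Qed.

Lemma rk_inj : injective rk.
Proof. by move=> x y /index_inj; apply; rewrite ?mem_l. Qed.

Lemma rk_lt x : rk x < n.
Proof. by rewrite -[n in _ < n]l_size index_mem mem_l. Qed.

Lemma rk_onto i : i < n -> exists v, rk v = i.
Proof.
move=> iN; exists (nth (Ordinal iN) l i); rewrite index_uniq ?l_size //.
Qed.

Definition ordered s := [/\ inp s, forall x : 'I_n, s 8 (rk x) = x.+1 & forall x : 'I_n, s 7 x.+1 = code (par x)].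

Lemma ordered_frame p s s' : ordered s -> bounded s' -> frame p s s' ->
  all (fun a => a \notin writes p) [:: 0; 1; 2; 3; 5; 7; 8] -> ordered s'.
Proof.
move=> [is_ s8 s7] bs fr wr.
split; [apply: inp_frame is_ bs fr _|move=> x|move=> x]; move: wr => /= /and5P[w0 w1 w2 w3 /and4P[w5 w7 w8 _]].
- by rewrite w0 w1 w2 w3 w5.
- by rewrite fr.
- by rewrite fr.
Qed.

Lemma ordered_upd s a i v : ordered s -> bounded (update s a i v) ->
  a \notin [:: 0; 1; 2; 3; 5; 7; 8] -> ordered (update s a i v).
Proof.
move=> [is_ s8 s7] bs; rewrite !inE !negb_or.
move=> /and5P[a0 a1 a2 a3 /and3P[a5 /negbTE a7 /negbTE a8]].
split; first by apply: inp_upd => //; rewrite !inE !negb_or a0 a1 a2 a3 a5.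
- by move=> x; rewrite /update [8 == a]eq_sym a8 /=.
- by move=> x; rewrite /update [7 == a]eq_sym a7 /=.
Qed.

Lemma ordered_env s : ordered s -> env s.
Proof. by case=> -[]. Qed.

Lemma alive_par s A x : alive s A -> s 6 (code (par x)) = if par x is Some p then (p \in A) : nat else 0.
Proof. by move=> [a0 al]; case: (par x) => /=. Qed.

Lemma top_spec s A : ordered s -> alive s A -> 
  wp p_top (fun s' => if A == set0 then s' 14 0 = 0 else
    exists t, [/\ is_top par A t, s' 14 0 = t.+1 & forall x, x \in A -> rk x <= rk t]) s.
Proof.
move=> os al; have es := ordered_env os; have [bs _ _] := es.
apply: wp_seq; wwrite => bs1.
set s0 := update _ _ _ _.
have os0 : ordered s0 by apply: ordered_upd.
have al0 : alive s0 A by case: al => a0 al; split.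
apply: (wp_for X2 XB (I := fun k s1 =>
   (s1 14 0 = 0 /\ forall x, x \in A -> k <= rk x) \/
   exists t, [/\ t \in A, s1 14 0 = t.+1 & forall x, x \in A -> rk x < k -> rk x <= rk t])) => //.
- exact: ordered_env.
- by left.
- move=> k s1 kn es1 s1k fr I; have [bs2 _ _] := es1.
  have [_ o8 _] : ordered s1 by apply: ordered_frame os0 bs2 fr _.
  have al1 : alive s1 A by apply: alive_frame al0 fr _.
  have [v rkv] := rk_onto kn; have s8 : s1 8 k = v.+1 by rewrite -rkv.
  apply: (wp_if X2 XB) => //=; rewrite s1k s8 al1.2 => h.
    wwrite => bs3; right; exists v; split; first by case: (v \in A) h.
      by rewrite /update /= s1k s8.
    by move=> x _; rewrite rkv ltnS.
  have vA : v \notin A by case: (v \in A) h.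
  have ne x : x \in A -> rk x != k.
    by move=> xA; apply: contraNneq vA; rewrite -rkv => /rk_inj <-.
  apply: wp_skip => //; case: I => [[I1 I2]|[t [tA t1 I2]]].
    by left; split=> // x xA; rewrite ltn_neqAle eq_sym ne // I2.
  right; exists t; split=> // x xA; rewrite ltnS leq_eqVlt (negbTE (ne x xA)) /=.
  exact: I2.
- move=> s1 bs2 fr; case: eqP => [->|A0] [[I1 I2]|[t [tA I1 I2]]] //.
  + by rewrite inE in tA.
  + have [x xA] : exists x, x \in A by apply/set0Pn/eqP.
    by move: (I2 x xA); rewrite leqNgt rk_lt.
  + exists t; split=> // [|x xA]; last by apply: I2 => //; apply: rk_lt.
    rewrite /is_top tA /=; case E: (par t) => [y|] //.
    by apply/negP => yA; move: (I2 y yA (rk_lt y)); rewrite leqNgt (rk_par E).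
Qed.

Definition tops (s : store) A := forall x, x \in A ->
  exists t, [/\ is_top par A t, x \in desc A t & s 9 x.+1 = t.+1].

Lemma tops_spec s A : ordered s -> alive s A -> wp p_tops (fun s' => tops s' A) s.
Proof.
move=> os al.
apply: (wp_for X2 XB (I := fun k s1 => forall x, x \in A -> n <= rk x + k ->
    exists t, [/\ is_top par A t, x \in desc A t & s1 9 x.+1 = t.+1])) => //.
- exact: ordered_env.
- by move=> x _; have := rk_lt x; lia.
- move=> k s1 kn es1 s1k fr I; have [bs2 s10 _] := es1.
  have os1 : ordered s1 by apply: ordered_frame os bs2 fr _.
  have [_ o8 o7] := os1.
  have al1 : alive s1 A by apply: alive_frame al fr _.
  have kn' : n - 1 - k < n by lia.
  have [v rkv] := rk_onto kn'; have s8 : s1 8 (n - 1 - k) = v.+1 by rewrite -rkv.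
  have vX : v.+1 <= X by apply: leq_trans nX.
  have X1 : X <= X ^ 2 by rewrite expnS expn1 leq_pmull //; lia.
  apply: wp_seq; apply: (wp_put X2 XB (0) (v.+1)) => //=; first by rewrite s1k s10.
    exact: leq_trans X1.
  move=> bs3; apply: wp_seq; apply: (wp_put X2 XB (0) (code (par v))) => //=.
    by rewrite /update /= o7.
    by case: (par v) => [p|] //=; apply: (leq_trans (leq_trans (ltn_ord p) nX) X1).
  move=> bs4; have ap := alive_par v al1.
  pose val := if par v is Some p then if p \in A then s1 9 p.+1 else v.+1 else v.+1.
  apply: (wp_put X2 XB (v.+1) (val)) => //=.
  - rewrite /update /= ap /val; case: (par v) => [p|] /=; last by lia.
    by case: (p \in A); lia.
  - by rewrite expn1 /val; case: (par v) => [p|] //; case: ifP => // _; rewrite -(expn1 X); apply: bs2.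
  move=> _ x xA xk; rewrite /update /= /val.
  have [xv|xv] := eqVneq x v; last first.
    have -> : (x.+1 == v.+1) = false by apply: contraNF xv => /eqP[/val_inj ->].
    apply: I => //; have : rk x != rk v by rewrite (inj_eq rk_inj).
    by rewrite rkv; lia.
  rewrite xv eqxx in xA *; case E: (par v) => [p|] /=; last first.
    by exists v; rewrite /is_top xA E mem_desc.
  have [pA|pA] := boolP (p \in A); last first.
    by exists v; rewrite /is_top xA E pA mem_desc // (negbTE pA).
  have [|t [tt pt ->]] := I p pA; first by have := rk_par E; rewrite rkv; lia.
  exists t; split=> //.
  move: pt; rewrite !inE => /and3P[_ -> c']; rewrite xA /=.
  by apply: connect_trans (connect1 _) c'; rewrite upE xA pA E /=.
- by move=> s1 _ _ I x xA; apply: I => //; lia.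
Qed.

Lemma tops_desc s A t x : tops s A -> is_top par A t -> x \in A ->
  (s 9 x.+1 == t.+1) = (x \in desc A t).
Proof.
move=> tp tt xA; have [t' [tt' xt' ->]] := tp x xA.
apply/eqP/idP => [[/val_inj <-] //|xt].
have E : desc A t = desc A t' by rewrite -(top_desc e_par tt xt) (top_desc e_par tt' xt').
have -> // : t' = t; apply: (top_inj (par := par) (A := A)) => //.
by rewrite E; apply: mem_desc; case/andP: tt'.
Qed.

Lemma weight_spec s A t : ordered s -> alive s A -> tops s A -> is_top par A t ->
  s 14 0 = t.+1 -> wp p_weight (fun s' => s' 13 0 = weight w (desc A t)) s.
Proof.
move=> os al tp tt s14; have es := ordered_env os; have [bs _ _] := es.
apply: wp_seq; wwrite => bs1.
set s0 := update _ _ _ _.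
have os0 : ordered s0 by apply: ordered_upd.
have al0 : alive s0 A by case: al => a0 al; split.
pose Hk k := [set x in desc A t | x < k].
have Hk_le k : weight w (Hk k) <= X ^ 2.
  apply: (@leq_trans (\sum_(x in Hk k) X)); first exact: leq_sum.
  rewrite sum_nat_const -mulnn leq_mul2r (leq_trans (max_card _)) ?orbT //.
  by rewrite card_ord.
apply: (wp_for X2 XB (I := fun k s1 => s1 13 0 = weight w (Hk k))) => //.
- exact: ordered_env.
- by rewrite /update /= /weight big1 // => x; rewrite inE ltn0 andbF.
- move=> k s1 kn es1 s1k fr I; have [bs2 _ _] := es1.
  have [[_ _ _ s3] _ _] : ordered s1 by apply: ordered_frame os0 bs2 fr _.
  pose v := Ordinal kn.
  have HkS : Hk k.+1 = if v \in desc A t then v |: Hk k else Hk k.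
    exact: (prefixS _ v).
  have test : (v \in A) * ((s1 9 v.+1 <= s1 14 0) * (s1 14 0 <= s1 9 v.+1)) = (v \in desc A t).
    rewrite !fr // /s0 /update /= s14 mulnb -eqn_leq.
    case: (boolP (v \in A)) => vA; first by rewrite (tops_desc tp tt vA) mul1n.
    by rewrite mul0n; case: (boolP (v \in _)) => // /(subsetP (desc_sub _ _ _)); rewrite (negbTE vA).
  have alv : s1 6 v.+1 = (v \in A) by rewrite fr // al0.2.
  apply: (wp_if X2 XB) => //=; rewrite s1k addn1 alv test HkS.
    case vH : (v \in desc A t) => // _; have vk : v \notin Hk k by rewrite inE ltnn andbF.
    apply: (wp_write X2 XB) => //.
      rewrite /= s1k I (s3 v); apply: leq_trans (Hk_le k.+1).
      by rewrite HkS vH /weight big_setU1 //= addnC.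
    by move=> _; rewrite /update /= s1k I (s3 v) /weight big_setU1 //= addnC.
  by case: (v \in desc A t) => // _; apply: wp_skip.
- move=> s1 _ _ ->; congr weight; apply/setP => x; rewrite inE ltn_ord andbT //.
Qed.

End Verification.

(** * The program: knapsack tables *)

Definition p_setrow y z :=
  PWrite 10 (get 29) y ;;
  PFor 26 false (PWrite 11 (add (mul (get 29) (get 0)) (get 26)) z).

Definition row x k := add (mul x (add (get 5) (Const 1))) k.

Definition p_init :=
  PFor 18 false
    (PFor 23 true
       (set_reg 29 (row (add (get 18) (Const 1)) (get 23)) ;;
        p_setrow (Const 0) (Const 0)) ;;
     set_reg 29 (row (add (get 18) (Const 1)) (get 5)) ;;
     p_setrow (Read 2 (get 18)) (eqe (get 26) (get 18))).

Definition p_rows :=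
  PFor 23 true
    (PWrite 12 (get 23) (get 5) ;;
     PIf (mul (le (get 27) (get 23))
              (le (Read 10 (row (get 34) (sub (get 23) (get 27)))) (Read 10 (row (get 34) (get 5)))))
       (PWrite 12 (get 23) (sub (get 23) (get 27))) PSkip).

Definition p_commit :=
  p_setrow (add (Read 10 (get 30)) (Read 10 (get 31)))
    (le (Const 1) (add (Read 11 (add (mul (get 30) (get 0)) (get 26)))
                       (Read 11 (add (mul (get 31) (get 0)) (get 26))))).

Definition cand_cost j :=
  add (Read 10 (row (get 28) (sub (get 23) j))) (Read 10 (row (get 34) (Read 12 j))).

(** The update is done in place: row [k] reads rows [k - j] of the parent, so [k] runs downwards.
    Masks are copied only after the best split of a row is known, so that a merge takes O(R (R + n))
    steps. *)
Definition p_merge :=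
  set_reg 29 (row (get 28) (get 5)) ;;
  set_reg 30 (get 29) ;;
  set_reg 31 (row (get 34) (Read 12 (sub (get 5) (Const 1)))) ;;
  p_commit ;;
  PFor 33 true
    (set_reg 23 (sub (sub (get 5) (Const 1)) (get 33)) ;;
     set_reg 25 (Const 0) ;;
     PFor 24 true
       (PIf (mul (le (get 24) (get 23)) (le (cand_cost (get 24)) (cand_cost (get 25))))
          (set_reg 25 (get 24)) PSkip) ;;
     set_reg 29 (row (get 28) (get 23)) ;;
     set_reg 30 (row (get 28) (sub (get 23) (get 25))) ;;
     set_reg 31 (row (get 34) (Read 12 (get 25))) ;;
     p_commit).

(** The top found by [p_top] is the alive vertex of highest rank, so it is treated last among the
    alive ones, and array 12 is left with its best rows. *)
Definition p_dp :=
  PFor 16 false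
    (set_reg 34 (Read 8 (get 16)) ;;
     PIf (Read 6 (get 34))
       (set_reg 27 (quo (mul (Read 3 (sub (get 34) (Const 1)))
                             (mul (Const 2) (sub (get 5) (Const 1)))) (get 13)) ;;
        p_rows ;;
        set_reg 28 (Read 7 (get 34)) ;;
        PIf (Read 6 (get 28)) p_merge PSkip)
       PSkip).

Lemma pair_eq m a b a' b' : b < m -> b' < m ->
  (a * m + b == a' * m + b') = (a == a') && (b == b').
Proof.
move=> bm b'm; apply/eqP/andP => [E|[/eqP -> /eqP ->] //].
have m0 : 0 < m by lia.
split; apply/eqP; last by rewrite -(modn_small bm) -(modn_small b'm) -(modnMDl a) E modnMDl.
by rewrite -[a]addn0 -(divn_small bm) -divnMDl // E divnMDl // divn_small // addn0.
Qed.

Section Verification.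
Variables (n R X B : nat) (e : rel 'I_n) (c w : 'I_n -> nat).
Hypotheses (X2 : 2 <= X) (XB : X ^ kexp <= B) (nX : n <= X).
Hypotheses (cX : forall v, c v <= X) (wX : forall v, w v <= X).

Local Notation wp := (wp n R X B dexp).
Local Notation env := (env n R X dexp).
Local Notation bounded := (bounded X dexp).

Definition row_mask (s : store) r : {set 'I_n} := [set x : 'I_n | s 11 (r * n + x) != 0].

Definition row_update (s s' : store) rd v (S : {set 'I_n}) :=
  [/\ s' 10 rd = v, forall r, r != rd -> s' 10 r = s 10 r, row_mask s' rd = S &
      forall r, r != rd -> row_mask s' r = row_mask s r].

(** The premise on [z] allows the mask expression to read the row being overwritten: when column [x]
    is computed, its old entries are still there. *)
Lemma setrow_spec y z s rd v (S : {set 'I_n}) : env s -> pexp kexp dexp (p_setrow y z) ->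
  eexp dexp z <= kexp ->
  s 29 0 = rd -> ev s y = v -> v <= X ^ 2 ->
  (forall s1 (x : 'I_n), (forall a j, a \notin [:: 10; 11; 26] -> s1 a j = s a j) ->
     s1 26 0 = x -> (forall r, (r != rd) -> s1 11 (r * n + x) = s 11 (r * n + x)) ->
     s1 11 (rd * n + x) = s 11 (rd * n + x) -> ev s1 z = (x \in S)) ->
  wp (p_setrow y z) (fun s' => row_update s s' rd v S) s.
Proof.
move=> es /= /andP[py pz] ez s29 yv vX zS; have [bs s0 s5] := es.
apply: wp_seq; apply: (wp_put X2 XB rd v) => //= bs1.
set s1 := update _ _ _ _ in bs1 *.
have es1 : env s1 by apply: env_upd.
apply: (wp_for X2 XB (I := fun k s2 => forall r (x : 'I_n),
   s2 11 (r * n + x) = if (r == rd) && (x < k) then (x \in S) : nat else s 11 (r * n + x))) => //.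
- by move=> r x; rewrite ltn0 andbF.
- move=> k s2 kn [bs2 s20 _] s2k fr I; pose x := Ordinal kn.
  apply: (wp_put X2 XB (rd * n + x) (x \in S)) => //=.
  + by rewrite fr // /s1 /update /= s29 s20 s2k.
  + apply: zS => //.
    * move=> a j; rewrite !inE !negb_or => /and3P[a1 a2 a3].
      by rewrite fr /s1 /update ?(negbTE a1) //= !inE negb_or a3.
    * by move=> r rrd; rewrite I (negbTE rrd).
    * by rewrite I ltnn andbF.
  + by case: (x \in S).
  move=> _ r y'; rewrite /update /= pair_eq // I ltnS [y' <= k]leq_eqVlt.
  by case: (r == rd) => //=; case: eqP => // yk; congr (nat_of_bool (_ \in S)); apply: val_inj.
- move=> s2 bs2 fr I; split.
  + by rewrite fr // /s1 /update /= eqxx.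
  + by move=> r rrd; rewrite fr // /s1 /update /= (negbTE rrd).
  + by apply/setP => x; rewrite !inE I eqxx ltn_ord; case: (x \in S).
  + by move=> r rrd; apply/setP => x; rewrite !inE I (negbTE rrd).
Qed.

Definition rowid (u : 'I_n) k := u.+1 * R.+1 + k.
Definition table (s : store) u k := s 10 (rowid u k).
Definition selection (s : store) u k := row_mask s (rowid u k).

Lemma rowid_eq u k u' k' : k <= R -> k' <= R ->
  (rowid u k == rowid u' k') = (u == u') && (k == k').
Proof. by move=> kR k'R; rewrite pair_eq. Qed.

Lemma ev_row s x k : s 5 0 = R -> ev s (row x k) = ev s x * R.+1 + ev s k.
Proof. by move=> /= ->; rewrite addn1. Qed.

Lemma tab_update s s' u k v S u' k' : row_update s s' (rowid u k) v S -> k <= R -> k' <= R ->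
  table s' u' k' = (if (u' == u) && (k' == k) then v else table s u' k') /\
  selection s' u' k' = (if (u' == u) && (k' == k) then S else selection s u' k').
Proof.
move=> [t1 t2 m1 m2] kR k'R; have := rowid_eq u' u k'R kR; rewrite /table /selection.
case: eqVneq => [-> <-|ne <-]; first by rewrite t1 m1.
by rewrite t2 ?m2.
Qed.

Lemma init_spec s : env s -> (forall v : 'I_n, s 2 v = c v) ->
  wp p_init (fun s' => [/\ forall u k, k < R -> table s' u k = 0,
     forall u k, k < R -> selection s' u k = set0, forall u, table s' u R = c u &
     forall u, selection s' u R = [set u]]) s.
Proof.
move=> es s2.
pose P s u k := table s u k = (if k < R then 0 else c u) /\ selection s u k = if k < R then set0 else [set u].
apply: (wp_for X2 XB (I := fun m s1 => forall (u : 'I_n) k, u < m -> k <= R -> P s1 u k)) => //.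
- move=> m s1 mn es1 s1m fr I; pose u := Ordinal mn.
  apply: wp_seq.
  apply: (wp_for X2 XB (I := fun j s2 => forall (u' : 'I_n) k, k <= R ->
     (u' < m) || ((u' == u) && (k < j)) -> P s2 u' k)) => //.
  + by move=> u' k kR; rewrite ltn0 andbF orbF => um; apply: I.
  + move=> j s3 jR es3 s3j fr3 I3; have [bs3 s30 s35] := es3.
    apply: wp_seq; apply: (wp_set X2 XB 0 (rowid u j)) => //.
      by rewrite ev_row //= fr3 // s1m s3j addn1.
    move=> bs4; have es4 := env_upd es3 bs4 (isT : 29 \notin [:: 0; 5]).
    apply: (wp_conseq (setrow_spec (rd := rowid u j) (v := 0) (S := set0) es4 _ _ _ _ _ _)) => //.
      by move=> s5 x _ _ _ _; rewrite inE.
    move=> s5 bs5 fr5 ru u' k kR h; rewrite /P.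
    have [h1 h2] := tab_update u' ru (ltnW jR) kR.
    change (P s5 u' k); rewrite /P h1 h2; case: eqP => [E|ne] /=.
      by case: (eqVneq k j) => [->|kj]; rewrite ?jR //; apply: (I3 u' k kR); move: h; rewrite ltnS [k <= j]leq_eqVlt (negbTE kj).
    by apply: (I3 u' k kR); move: h; case: eqP.
  + move=> s3 bs3 fr3 I3; have es3 := env_frame es1 bs3 fr3 isT isT.
    have [_ _ s35] := es3.
    have s318 : s3 18 0 = m by rewrite fr3.
    apply: wp_seq; apply: (wp_set X2 XB 0 (rowid u R)) => //.
      by rewrite ev_row //= s318 s35 addn1.
    move=> bs4; have es4 := env_upd es3 bs4 (isT : 29 \notin [:: 0; 5]).
    apply: (wp_conseq (setrow_spec (rd := rowid u R) (v := c u) (S := [set u]) es4 _ _ _ _ _ _)) => //.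
    * by rewrite /update /= s318 fr3 // fr // (s2 u).
    * by apply: leq_trans (cX u) _; rewrite expnS expn1 leq_pmull //; lia.
    * move=> s5 x fr5 s5x _ _ /=; rewrite s5x fr5 // /update /= s318.
      by rewrite mulnb -eqn_leq inE.
    move=> s5 bs5 fr5 ru u' k; rewrite ltnS => um kR.
    have [h1 h2] := tab_update u' ru (leqnn R) kR.
    change (P s5 u' k); rewrite /P h1 h2; case: eqP => [E|ne] /=.
      case: (eqVneq k R) => [->|kj]; rewrite ?ltnn ?E //; apply: (I3 u k kR).
      by rewrite eqxx [k < R]ltn_neqAle kj kR orbT.
    apply: (I3 u' k kR); rewrite ltn_neqAle um andbT; apply/orP; left.
    by apply/eqP => E; apply: ne; apply: val_inj.
- move=> s1 bs1 _ I; split=> [u k kR|u k kR|u|u].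
  + by case: (I u k (ltn_ord u) (ltnW kR)); rewrite kR.
  + by case: (I u k (ltn_ord u) (ltnW kR)); rewrite kR.
  + by case: (I u R (ltn_ord u) (leqnn R)); rewrite ltnn.
  + by case: (I u R (ltn_ord u) (leqnn R)); rewrite ltnn.
Qed.

Lemma rows_spec s (v : 'I_n) (wr : 'I_n -> nat) : env s -> s 34 0 = v.+1 -> s 27 0 = wr v ->
  wp p_rows (fun s' => forall j, j < R -> s' 12 j = best_row wr R (table s) v j) s.
Proof.
move=> es s34 s27.
apply: (wp_for X2 XB (I := fun k s1 => forall j, j < k -> s1 12 j = best_row wr R (table s) v j)) => //.
move=> k s1 kR es1 s1k fr I; have [bs1 s10 s15] := es1.
apply: wp_seq; apply: (wp_set X2 XB k R) => // bs2.
set s2 := update _ _ _ _ in bs2 *.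
have test : ev s2 (mul (le (get 27) (get 23))
   (le (Read 10 (row (get 34) (sub (get 23) (get 27)))) (Read 10 (row (get 34) (get 5)))))
   = (wr v <= k) && (table s v (k - wr v) <= table s v R).
  have t10 j : s2 10 j = s 10 j by rewrite /s2 /update /= fr.
  have e27 : s2 27 0 = wr v by rewrite /s2 /update /= fr.
  have e34 : s2 34 0 = v.+1 by rewrite /s2 /update /= fr.
  have e23 : s2 23 0 = k by [].
  have e5 : s2 5 0 = R by [].
  by rewrite /= e27 e34 e23 e5 !t10 addn1 mulnb.
apply: (wp_if X2 XB) => //; rewrite test => h.
  apply: (wp_set X2 XB k (k - wr v)) => //=.
    by rewrite /s2 /update /= s1k fr // s27.
  move=> bs3 j; rewrite ltnS leq_eqVlt /best_row /s2 /update /=; case: eqP => /= [-> _|_ /I //].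
  by case: (_ && _) h.
apply: wp_skip => // j; rewrite ltnS leq_eqVlt /s2 /update /=; case: eqP => /= [-> _|_ /I //].
by rewrite /best_row; case: (_ && _) h.
Qed.

(** [r1 = rd] is allowed; it occurs for row [R] and for the split 0. *)
Lemma commit_spec s rd r1 r2 : env s -> s 29 0 = rd -> s 30 0 = r1 -> s 31 0 = r2 ->
  r2 != rd -> s 10 r1 + s 10 r2 <= X ^ 2 ->
  wp p_commit (fun s' => row_update s s' rd (s 10 r1 + s 10 r2)
     (row_mask s r1 :|: row_mask s r2)) s.
Proof.
move=> es s29 s30 s31 r2d le2; have [bs s0 s5] := es.
apply: setrow_spec => //; first by rewrite /= s30 s31.
move=> s1 x fr s1x o1 o2 /=; rewrite !(fr 30) // !(fr 31) // !(fr 0) // s30 s31 s0 s1x.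
rewrite (o1 r2) //; have -> : s1 11 (r1 * n + x) = s 11 (r1 * n + x).
  by case: (eqVneq r1 rd) => [->|/o1].
by rewrite !inE addn_gt0 !lt0n.
Qed.


Lemma merge_spec s (v p : 'I_n) (wr : 'I_n -> nat) : env s -> 0 < R ->
  s 34 0 = v.+1 -> s 28 0 = p.+1 -> v != p ->
  (forall j, j < R -> s 12 j = best_row wr R (table s) v j) ->
  (forall k j, k <= R -> j < R -> table s p k + table s v (best_row wr R (table s) v j) <= X ^ 2) ->
  wp p_merge (fun s' => merged wr R (table s) (table s') (selection s) (selection s') v p) s.
Proof.
move=> es R0 s34 s28 vp s12 cap; have [bs s0 s5] := es.
set b := best_row wr R (table s) v in s12 cap *.
have bR j : j < R -> b j <= R by apply: best_row_le.
have ev34 s1 k : s1 34 0 = v.+1 -> s1 5 0 = R -> ev s1 (row (get 34) k) = rowid v (ev s1 k).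
  by move=> h1 h2; rewrite ev_row //= h1.
have ev28 s1 k : s1 28 0 = p.+1 -> s1 5 0 = R -> ev s1 (row (get 28) k) = rowid p (ev s1 k).
  by move=> h1 h2; rewrite ev_row //= h1.
have RmR : R.-1 < R by lia.
apply: wp_seq; apply: (wp_set X2 XB 0 (rowid p R)) => //; first by rewrite ev28 //= s5.
move=> bs1; apply: wp_seq; apply: (wp_set X2 XB 0 (rowid p R)) => //.
move=> bs2; apply: wp_seq; apply: (wp_set X2 XB 0 (rowid v (b R.-1))) => //.
  by rewrite ev34 //= /update /= s5 subn1 s12.
move=> bs3; have es3 := env_upd (env_upd (env_upd es bs1 isT) bs2 isT) bs3 isT.
apply: wp_seq; apply: (wp_conseq (commit_spec (rd := rowid p R) (r1 := rowid p R)
   (r2 := rowid v (b R.-1)) es3 _ _ _ _ _)) => //.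
- by rewrite rowid_eq ?bR // (negbTE vp).
- exact: cap.
set s3 := update _ _ _ _ in bs3 es3 *.
have {bs1 bs2 bs3} t3 u k : table s3 u k = table s u k by [].
have m3 u k : selection s3 u k = selection s u k by [].
move=> s4 bs4 fr4 ru; have es4 := env_frame es3 bs4 fr4 isT isT.
have fr34 a j : a \notin [:: 10; 11; 26; 29; 30; 31] -> s4 a j = s a j.
  rewrite !inE !negb_or => /and5P[a1 a2 a3 a4 /andP[a5 a6]].
  rewrite fr4; last by rewrite !inE !negb_or a1 a2 a3.
  by rewrite /s3 /update (negbTE a4) (negbTE a5) (negbTE a6).
pose D s2 k := exists j, [/\ j <= k, table s2 p k = table s p (k - j) + table s v (b j),
   selection s2 p k = selection s p (k - j) :|: selection s v (b j) &
   forall j, j <= k -> table s2 p k <= table s p (k - j) + table s v (b j)].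
(* After [m] iterations the rows from [R - m] to [R - 1] are new, and those below still hold the old
   entries needed later. *)
pose J m s2 := [/\ table s2 p R = table s p R + table s v (b R.-1),
   selection s2 p R = selection s p R :|: selection s v (b R.-1),
   forall u k, k <= R -> u != p -> table s2 u k = table s u k /\ selection s2 u k = selection s u k,
   forall k, k < R - m -> table s2 p k = table s p k /\ selection s2 p k = selection s p k &
   forall k, R - m <= k -> k < R -> D s2 k].
apply: (wp_for X2 XB (I := J)) => //; last first.
- move=> s5' bs5 fr5 [J1 J2 J3 _ J5]; split=> // k kR; apply: J5 => //; lia.
- move=> m s5' mR es5 s5m fr5 [J1 J2 J3 J4 J5]; have [bs5 s50 s55] := es5.
  have frs a j : a \notin [:: 10; 11; 23; 24; 25; 26; 29; 30; 31; 33] -> s5' a j = s a j.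
    rewrite !inE !negb_or => /and5P[a1 a2 a3 a4 /and5P[a5 a6 a7 a8 /andP[a9 a10]]].
    rewrite fr5 ?fr34 // !inE !negb_or ?a1 ?a2 ?a3 ?a4 ?a5 ?a6 ?a7 ?a8 ?a9 ?a10 //.
  pose k := R - 1 - m; have kR : k < R by rewrite /k; lia.
  apply: wp_seq; apply: (wp_set X2 XB 0 k) => //; first by rewrite /= s5m s55.
  move=> bs6; apply: wp_seq; apply: (wp_set X2 XB 0 0) => // bs7.
  have es7 := env_upd (env_upd es5 bs6 isT) bs7 isT.
  set s7 := update _ _ _ _ in bs7 es7 *.
  have fr7 a j : a \notin [:: 23; 25] -> s7 a j = s5' a j.
    by rewrite !inE !negb_or /s7 /update => /andP[/negbTE -> /negbTE ->].
  have tp j : j <= k -> s7 10 (rowid p (k - j)) = table s p (k - j).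
    by move=> jk; rewrite fr7 //; case: (J4 (k - j)) => //; rewrite /k; lia.
  have tv j : j < R -> s7 10 (rowid v (b j)) = table s v (b j).
    by move=> jR; rewrite fr7 //; case: (J3 v (b j)) => //; apply: bR.
  pose cost j := table s p (k - j) + table s v (b j).
  apply: wp_seq; apply: (wp_conseq (wp_for X2 XB (I := fun j s8 => s8 25 0 <= k /\
     forall j', j' < j -> j' <= k -> cost (s8 25 0) <= cost j')
     (Q := fun s8 => s8 25 0 <= k /\ forall j', j' <= k -> cost (s8 25 0) <= cost j') es7 _ _ _ _)) => //.
  + move=> j s8 jR es8 s8j fr8 [le8 min8]; have [bs8 s80 s85] := es8.
    have e12 i : i < R -> s8 12 i = b i by move=> iR; rewrite fr8 // fr7 // frs // s12.
    have e34 : s8 34 0 = v.+1 by rewrite fr8 // fr7 // frs.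
    have e28 : s8 28 0 = p.+1 by rewrite fr8 // fr7 // frs.
    have e23 : s8 23 0 = k by rewrite fr8.
    have costE y i : ev s8 y = i -> i <= k -> ev s8 (cand_cost y) = cost i.
      move=> yi ik; have iR : i < R by apply: leq_ltn_trans kR.
      change (s8 10 (ev s8 (row (get 28) (sub (get 23) y))) +
              s8 10 (ev s8 (row (get 34) (Read 12 y))) = cost i).
      rewrite ev28 // ev34 //= yi e12 // e23 !(fr8 10) //.
      by rewrite tp // tv.
    have test : ev s8 (mul (le (get 24) (get 23)) (le (cand_cost (get 24)) (cand_cost (get 25))))
      = (j <= k) && (cost j <= cost (s8 25 0)) :> nat.
      rewrite -mulnb.
      change ((s8 24 0 <= s8 23 0) * (ev s8 (cand_cost (get 24)) <= ev s8 (cand_cost (get 25)))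
        = (j <= k) * (cost j <= cost (s8 25 0))).
      rewrite s8j e23; case: (leqP j k) => // jk.
      by rewrite (costE _ j) // (costE _ (s8 25 0)).
    apply: (wp_if X2 XB) => //; rewrite test => h.
      have {h test} [jk le] : j <= k /\ cost j <= cost (s8 25 0).
        by apply/andP; case: (_ && _) h.
      apply: (wp_set X2 XB 0 j) => // _; split=> [|j']; rewrite /update /= //.
      by rewrite ltnS leq_eqVlt => /predU1P[->//|/min8 h /h]; apply: leq_trans.
    apply: wp_skip => //; split=> // j'; rewrite ltnS leq_eqVlt /update /=.
    move=> /predU1P[-> jk|/min8 //]; move: h; rewrite jk /= leqNgt.
    by case: ltnP => // /ltnW.
  + by move=> s8 bs8 _ [le8 min8]; split=> // j' j'k; apply: min8 => //; lia.
  move=> s8 bs8 fr8 [le8 min8]; have es8 := env_frame es7 bs8 fr8 isT isT.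
  have [_ s80 s85] := es8.
  set j := s8 25 0 in le8 min8; have jR : j < R by apply: leq_ltn_trans kR.
  have e12 : s8 12 j = b j by rewrite fr8 // fr7 // frs // s12.
  have e34 : s8 34 0 = v.+1 by rewrite fr8 // fr7 // frs.
  have e28 : s8 28 0 = p.+1 by rewrite fr8 // fr7 // frs.
  have e23 : s8 23 0 = k by rewrite fr8.
  apply: wp_seq; apply: (wp_set X2 XB 0 (rowid p k)) => //; first by rewrite ev28 //= e23.
  move=> bs9; apply: wp_seq; apply: (wp_set X2 XB 0 (rowid p (k - j))) => //.
    by rewrite ev28 //= /update /= e23.
  move=> bs10; apply: wp_seq; apply: (wp_set X2 XB 0 (rowid v (b j))) => //.
    by rewrite ev34 //= /update /= e12.
  move=> bs11; have es11 := env_upd (env_upd (env_upd es8 bs9 isT) bs10 isT) bs11 isT.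
  have tE u i : s8 10 (rowid u i) = table s5' u i by rewrite fr8 // fr7.
  have mE u i : row_mask s8 (rowid u i) = selection s5' u i.
    by apply/setP => x; rewrite !inE fr8 // fr7.
  have k_old : k < R - m by rewrite /k; lia.
  have kj_old : k - j < R - m by rewrite /k; lia.
  apply: (wp_conseq (commit_spec (rd := rowid p k) (r1 := rowid p (k - j))
     (r2 := rowid v (b j)) es11 _ _ _ _ _)) => //.
  + by rewrite rowid_eq ?bR ?(ltnW kR) // (negbTE vp).
  + rewrite /update /= !tE; have [-> _] := J4 _ kj_old; have [-> _] := J3 v (b j) (bR j jR) vp.
    by apply: cap => //; lia.
  move=> s12' bs12 fr12 ru2'.
  have ru2 : row_update s8 s12' (rowid p k) (cost j) (selection s p (k - j) :|: selection s v (b j)).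
    have [E1 E2] := J4 _ kj_old; have [E3 E4] := J3 v (b j) (bR j jR) vp.
    by rewrite /cost -E1 -E2 -E3 -E4 -!tE -!mE; apply: ru2'.
  have upd u i : i <= R -> table s12' u i = (if (u == p) && (i == k) then cost j else table s5' u i) /\
      selection s12' u i = (if (u == p) && (i == k) then selection s p (k - j) :|: selection s v (b j) else selection s5' u i).
    move=> iR; have [h1 h2] := tab_update u ru2 (ltnW kR) iR.
    by rewrite h1 h2 -tE -mE.
  change (J m.+1 s12'); split.
  + by have [-> _] := upd p R (leqnn R); rewrite gtn_eqF ?andbF.
  + by have [_ ->] := upd p R (leqnn R); rewrite gtn_eqF ?andbF.
  + by move=> u i iR up; have [-> ->] := upd u i iR; rewrite (negbTE up); apply: J3.
  + move=> i iR; have iR' : i <= R by lia.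
    have [-> ->] := upd p i iR'; rewrite ltn_eqF ?andbF; last by rewrite /k; lia.
    by apply: J4; lia.
  + move=> i iR iR'; have [E1 E2] := upd p i (ltnW iR'); rewrite /D E1 E2 eqxx.
    have [->|ne] := eqVneq i k; first by exists j; split.
    by apply: J5 => //; move: ne; rewrite /k; lia.
- change (J 0 s4); split=> //.
  + by have [-> _] := tab_update p ru (leqnn R) (leqnn R); rewrite !eqxx.
  + by have [_ ->] := tab_update p ru (leqnn R) (leqnn R); rewrite !eqxx.
  + move=> u k kR up; have [h1 h2] := tab_update u ru (leqnn R) kR.
    by move: h1 h2; rewrite (negbTE up) /= => -> ->.
  + move=> k; rewrite subn0 => kR; have [h1 h2] := tab_update p ru (leqnn R) (ltnW kR).
    by move: h1 h2; rewrite (ltn_eqF kR) andbF /= => -> ->.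
  + by move=> k; rewrite subn0; lia.
Qed.

End Verification.

(** * The program: main loop *)

(** This realises [elim_step]. The tops are computed while the queried vertex is still alive, since
    its component includes it; clearing its cell before the loop implements the condition
    [v != s]. *)
Definition p_place :=
  p_tops ;;
  PWrite 6 (add (get 32) (Const 1)) (Const 0) ;;
  PFor 18 false
    (PIf (mul (Read 6 (add (get 18) (Const 1)))
              (eqe (Read 9 (add (get 18) (Const 1))) (Read 9 (add (get 32) (Const 1)))))
       (PWrite 4 (get 18) (add (get 32) (Const 1))) PSkip).

Definition p_select :=
  PFor 32 false
    (PIf (add (Read 11 (add (mul (row (get 14) (Read 12 (sub (get 5) (Const 1)))) (get 0)) (get 32)))
              (mul (le (get 13) (Const 0)) (eqe (add (get 32) (Const 1)) (get 14))))
       p_place PSkip).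

Definition p_phase :=
  p_top ;;
  PIf (get 14) (p_tops ;; p_weight ;; p_init ;; p_dp ;; p_select) PSkip.

(** n iterations suffice, as each phase queries some vertex; once none is left, [p_top] yields 0 and
    the remaining iterations do nothing else. *)
Definition p_main := PFor 15 false p_phase.

Section Verification.
Variables (n K X B : nat) (e : rel 'I_n) (c w : 'I_n -> nat).
Let R := (n * K).+1.
Hypotheses (X2 : 2 <= X) (XB : X ^ kexp <= B) (nX : n <= X) (n0 : 0 < n) (K1 : 1 < K).
Hypotheses (cX : forall v, c v <= X) (wX : forall v, w v <= X).
Variables (l : seq 'I_n) (par : 'I_n -> option 'I_n).
Hypotheses (l_uniq : uniq l) (l_size : size l = n).
Local Notation rk := (index^~ l).
Hypothesis rk_par : forall x y, par x = Some y -> rk x < rk y.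
Hypothesis e_par : forall x y, e x y = (par x == Some y) || (par y == Some x).

Local Notation wp := (wp n R X B dexp).
Local Notation env := (env n R X dexp).
Local Notation bounded := (bounded X dexp).
Local Notation desc := (desc par).
Local Notation ordered := (ordered R X e c w l par).
Local Notation tab := (@table n R).
Local Notation msk := (@selection n R).
Implicit Types (A S : {set 'I_n}) (D : rooted_tree 'I_n).

Let rkI : injective rk := rk_inj l_uniq l_size.

Lemma costs_le A : costs c A <= X ^ 2.
Proof.
apply: (@leq_trans (\sum_(x in A) X)); first exact: leq_sum.
rewrite sum_nat_const -mulnn leq_mul2r (leq_trans (max_card _)) ?orbT //.
by rewrite card_ord.
Qed.

Lemma tab_frame p s s' : frame p s s' -> 10 \notin writes p -> tab s' = tab s :> ('I_n -> _).
Proof. by move=> fr w10; apply/funext => u; apply/funext => k; rewrite /table fr. Qed.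

Lemma msk_frame p s s' : frame p s s' -> 11 \notin writes p -> msk s' = msk s :> ('I_n -> _).
Proof.
move=> fr w11; apply/funext => u; apply/funext => k.
by apply/setP => x; rewrite !inE fr.
Qed.

Lemma dp_spec s A t : ordered s -> alive s A -> is_top par A t ->
  (forall x, x \in A -> rk x <= rk t) -> s 13 0 = weight w (desc A t) ->
  (forall (u : 'I_n) k, k < R -> tab s u k = 0) ->
  (forall (u : 'I_n) k, k < R -> msk s u k = set0) ->
  (forall u : 'I_n, tab s u R = c u) -> (forall u : 'I_n, msk s u R = [set u]) ->
  let wr := rounded w n K (weight w (desc A t)) in
  wp p_dp (fun s' => [/\ sound par rk A c wr R n (tab s') (msk s'),
    optimal par rk A c wr R n (tab s') &
    forall j, j < R -> s' 12 j = best_row wr R (tab s') t j]) s.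
Proof.
move=> os al tt tmax s13 t0 m0 tR mR wr; have es := ordered_env os.
have [tA tpar] := andP tt.
apply: (wp_for X2 XB (I := fun i s1 => [/\ sound par rk A c wr R i (tab s1) (msk s1),
    optimal par rk A c wr R i (tab s1) &
    rk t < i -> forall j, j < R -> s1 12 j = best_row wr R (tab s1) t j])) => //.
- split=> //; last exact: init_optimal.
  exact: init_sound.
- move=> i s1 iN es1 s1i fr [snd opt ra]; have [bs1 s10 s15] := es1.
  have os1 : ordered s1 by apply: ordered_frame os bs1 fr _.
  have [[_ _ _ s13'] o8 o7] := os1.
  have al1 : alive s1 A by apply: alive_frame al fr _.
  have [v rkv] := rk_onto l_uniq l_size iN.
  apply: wp_seq; apply: (wp_set X2 XB 0 v.+1) => //; first by rewrite /= s1i -rkv o8.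
  move=> bs2; have es2 := env_upd es1 bs2 isT.
  have maxt : rk t < i.+1 -> v \in A -> v = t.
    move=> ti vA; apply: rkI; apply/eqP; rewrite eqn_leq tmax //=.
    by move: ti; rewrite ltnS -rkv.
  have skip s2 : tab s2 = tab s1 -> msk s2 = msk s1 ->
      (forall p, p \in A -> v \in A -> par v != Some p) ->
      sound par rk A c wr R i.+1 (tab s2) (msk s2) /\ optimal par rk A c wr R i.+1 (tab s2).
    move=> -> -> np; have [h1 h2] := skip_sound rkI c wr R (tab s1) (msk s1) np.
    by move: h1 h2; rewrite rkv => h1 h2; split; auto.
  have evh : ev (update s1 34 0 v.+1) (Read 6 (get 34)) = (v \in A) by apply: al1.2.
  apply: (wp_if X2 XB) => //; rewrite evh => h; last first.
    have vA : v \notin A by move: h; case: (v \in A).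
    have [|h1 h2] := skip s1 erefl erefl; first by move=> p _ vA1; rewrite vA1 in vA.
    apply: wp_skip => //; split=> // ti; apply: ra; move: ti.
    rewrite ltnS leq_eqVlt => /predU1P[E|//].
    by move: vA; have -> : v = t by [apply: rkI; rewrite rkv E]; rewrite tA.
  have vA : v \in A by case: (v \in A) h.
  apply: wp_seq; apply: (wp_set X2 XB 0 (wr v)) => //.
    by rewrite /= /update /= subn1 (s13' v) s15 fr // s13 /R subn1.
  move=> bs3; have es3 := env_upd es2 bs3 isT.
  apply: wp_seq; apply: (wp_conseq (rows_spec X2 XB (v := v) (wr := wr) es3 _ _)) => //.
  move=> s4 bs4 fr4 ra4; have es4 := env_frame es3 bs4 fr4 isT isT.
  have t4 : tab s4 = tab s1 := tab_frame fr4 isT.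
  have m4 : msk s4 = msk s1 := msk_frame fr4 isT.
  have [_ s40 s45] := es4.
  apply: wp_seq; apply: (wp_set X2 XB 0 (code (par v))) => //.
    by rewrite /= fr4 // fr4 // /update /= o7.
  move=> bs5; have es5 := env_upd es4 bs5 isT.
  set s5 := update _ _ _ _ in bs5 es5 *.
  have {}ra4 j : j < R -> s5 12 j = best_row wr R (tab s1) v j by apply: ra4.
  have ap : s5 6 (code (par v)) = if par v is Some p then (p \in A) : nat else 0.
    by rewrite -(alive_par par v al1) [LHS]fr4.
  apply: (wp_if X2 XB) => //; last first.
    move=> h0; have np p : p \in A -> v \in A -> par v != Some p.
      move=> pA _; apply/eqP => E; have {h0} : s5 6 (code (par v)) = 0 := h0.
      by rewrite ap E pA.
    have [h1 h2] := skip s5 t4 m4 np; apply: wp_skip => //; split=> // ti j jR.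
    by rewrite -(maxt ti vA) [tab _]t4; apply: ra4.
  move=> h0; have {h0} : s5 6 (code (par v)) != 0 := h0.
  rewrite ap; case E: (par v) => [p|] // pA'; have {pA'} pA : p \in A by case: (p \in A) pA'.
  have vt : v != t by apply: contraTneq pA => vt; move: tpar; rewrite -vt E.
  have vp : v != p by apply: contraTneq (rk_par E) => ->; rewrite ltnn.
  have tab5 : tab s5 = tab s1 := t4.
  have msk5 : msk s5 = msk s1 := m4.
  have opt' : optimal par rk A c wr R (rk v) (tab s1) by rewrite rkv.
  have snd' : sound par rk A c wr R (rk v) (tab s1) (msk s1) by rewrite rkv.
  apply: (wp_conseq (merge_spec X2 XB nX (v := v) (p := p) (wr := wr) es5 _ _ _ _ _ _)) => //.
  - by rewrite /s5 /update /= fr4.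
  - by rewrite /s5 /update /= E.
  - by rewrite tab5.
  - move=> k j kR jR; rewrite tab5; apply: leq_trans (costs_le A).
    by apply: (merge_le rk_par _ vA pA E opt').
  - rewrite tab5 msk5 => s6 bs6 fr6 mg; split.
    + by rewrite -rkv; apply: (merge_sound rk_par rkI _ vA pA E snd' mg).
    + by rewrite -rkv; apply: (merge_optimal rk_par rkI _ vA pA E opt' mg).
    + by move=> ti; move: vt; rewrite (maxt ti vA) eqxx.
- move=> s1 _ _ [snd opt ra]; split=> //; apply: ra; exact: rk_lt.
Qed.

Definition out (s : store) D := forall v : 'I_n, s 4 v = code (D v).

Definition in_state s (st : {set 'I_n} * rooted_tree 'I_n) := alive s st.1 /\ out s st.2.

Lemma place_spec s st (x : 'I_n) : ordered s -> in_state s st -> x \in st.1 -> s 32 0 = x ->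
  wp p_place (fun s' => in_state s' (elim_step e st x)) s.
Proof.
move: st => [A D] os [al ot] /= xA s32; have es := ordered_env os.
apply: wp_seq; apply: (wp_conseq (tops_spec X2 XB nX l_uniq l_size rk_par os al)) => s1 bs1 fr1 tp.
have es1 := env_frame es bs1 fr1 isT isT.
have e32 : s1 32 0 = x by rewrite fr1.
apply: wp_seq; apply: (wp_set X2 XB x.+1 0) => //; first by rewrite /= e32 addn1.
move=> bs2; have es2 := env_upd es1 bs2 isT; set s2 := update _ _ _ _ in bs2 es2 *.
have al2 : alive s2 (A :\ x).
  case: al => a0 al; split=> [|v]; first by rewrite /s2 /update /= fr1.
  by rewrite /s2 /update /= eqSS !inE -[v == x :> nat]/(v == x); case: eqP => //= _; rewrite fr1 // al.
have [t [tt xt tE]] := tp x xA.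
have cx : comp e A x = desc A t by apply: (top_desc e_par tt xt).
pose D' := (elim_step e (A, D) x).2.
have D'E v : D' v = if (v \in desc A t) && (v != x) then Some x else D v.
  by rewrite /D' ffunE cx.
apply: (wp_for X2 XB (I := fun k s3 => forall v : 'I_n,
    s3 4 v = if v < k then code (D' v) else code (D v))) => //.
- by move=> v; rewrite ltn0 [LHS]fr1.
- move=> k s3 kn [bs3 s30 s35] s3k fr3 I; pose v := Ordinal kn.
  have test : ev s3 (mul (Read 6 (add (get 18) (Const 1)))
       (eqe (Read 9 (add (get 18) (Const 1))) (Read 9 (add (get 32) (Const 1)))))
       = (v \in desc A t) && (v != x).
    have e32' : s3 32 0 = x by rewrite fr3.
    have e6 : s3 6 k.+1 = (v \in A :\ x) by rewrite fr3 // -(al2.2 v).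
    have e9x : s3 9 x.+1 = t.+1 by rewrite fr3 // -tE.
    have e9v : s3 9 k.+1 = s1 9 v.+1 by rewrite fr3.
    rewrite /= s3k e32' !addn1 e6 e9x e9v mulnb -eqn_leq mulnb in_setD1; congr nat_of_bool.
    case: eqVneq => //= _; rewrite ?andbF // andbT.
    have [vA|vA] := boolP (v \in A); first by rewrite (tops_desc e_par tp tt vA).
    by apply/esym/negbTE; apply: contra vA; apply/subsetP; apply: desc_sub.
  apply: (wp_if X2 XB) => //; rewrite test => h.
    apply: (wp_set X2 XB k x.+1) => //; first by rewrite /= fr3 // [s2 32 0]e32 addn1.
    move=> _ u; rewrite /update /= ltnS [u <= k]leq_eqVlt I; case: eqP => //= uk.
    have -> : u = v by apply: val_inj.
    by rewrite D'E; case: (_ && _) h.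
  apply: wp_skip => // u; rewrite /update /= ltnS [u <= k]leq_eqVlt I; case: eqP => //= uk.
  have -> : u = v by apply: val_inj.
  by rewrite ltnn D'E; case: (_ && _) h.
- move=> s3 bs3 fr3 I; split; first exact: (alive_frame al2 fr3 isT).
  by move=> v; rewrite I ltn_ord.
Qed.

Lemma select_spec s st S (t : 'I_n) : ordered s -> in_state s st -> S \subset st.1 ->
  s 14 0 = t.+1 -> s 12 R.-1 <= R ->
  (forall x, x \in S = (x \in msk s t (s 12 R.-1)) || (s 13 0 == 0) && (x == t)) ->
  wp p_select (fun s' => exists r, [/\ uniq r, r =i S & in_state s' (elim e st r)]) s.
Proof.
move=> os ist SA s14 s12 SE; have es := ordered_env os.
apply: (wp_for X2 XB (I := fun k s1 => exists r, [/\ uniq r, r =i [set x in S | x < k]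
    & in_state s1 (elim e st r)])) => //.
- by exists [::]; split=> // x; rewrite !inE ltn0 andbF.
- move=> k s1 kn es1 s1k fr [r [ur rE ist1]]; have [bs1 s10 s15] := es1.
  have os1 : ordered s1 by apply: ordered_frame os bs1 fr _.
  pose x := Ordinal kn.
  have test : (ev s1 (add (Read 11 (add (mul (row (get 14) (Read 12 (sub (get 5) (Const 1)))) (get 0)) (get 32)))
      (mul (le (get 13) (Const 0)) (eqe (add (get 32) (Const 1)) (get 14)))) != 0) = (x \in S).
    rewrite SE !inE /= s15 s10 s1k !fr // s14 !addn1 subn1.
    by rewrite mulnb -eqn_leq eqSS mulnb addn_eq0 negb_and eqb0 negbK leqn0.
  have rS := prefixS S x.
  apply: (wp_if X2 XB) => // h.
    have xS : x \in S by rewrite -test.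
    have xr : x \notin r by rewrite rE !inE ltnn andbF.
    apply: (wp_conseq (place_spec os1 ist1 (x := x) _ s1k)) => //.
      by rewrite elim_rest !inE xr (subsetP SA).
    move=> s2 bs2 fr2 ist2; exists (rcons r x); split.
    + by rewrite rcons_uniq xr.
    + by move=> y; rewrite mem_rcons inE rS xS in_setU1 rE.
    + by rewrite /elim -cats1 foldl_cat.
  have xS : x \notin S by rewrite -test h.
  apply: wp_skip => //; exists r; split=> // y.
  by rewrite rS (negbTE xS) rE.
- move=> s1 _ _ [r [ur rE ist1]]; exists r; split=> // x.
  by rewrite rE inE ltn_ord andbT.
Qed.

Lemma phase_spec s (st : {set 'I_n} * rooted_tree 'I_n) : ordered s -> in_state s st ->
  wp p_phase (fun s' => (st.1 = set0 /\ in_state s' st) \/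
    exists p, [/\ phase_ok e c w K st.1 p, p.2 != [::] & in_state s' (elim e st p.2)]) s.
Proof.
move=> os ist; have es := ordered_env os; have [al ot] := ist.
apply: wp_seq; apply: (wp_conseq (top_spec X2 XB l_uniq l_size rk_par os al)) => s1 bs1 fr1 tp.
have os1 : ordered s1 by apply: ordered_frame os bs1 fr1 _.
have es1 := ordered_env os1; have al1 := alive_frame al fr1 isT.
have ist1 : in_state s1 st by split=> // v; rewrite fr1 ?ot.
apply: (wp_if X2 XB) => //=; last first.
  move=> h; apply: wp_skip => //; left; split=> //.
  by move: tp; case: eqP => // _ [t [_]]; rewrite h.
move: tp; case: eqP => [_ ->//|_ [t [tt s1t tmax]] _].
apply: wp_seq; apply: (wp_conseq (tops_spec X2 XB nX l_uniq l_size rk_par os1 al1)) => s2 bs2 fr2 tp.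
have os2 : ordered s2 by apply: ordered_frame os1 bs2 fr2 _.
have al2 := alive_frame al1 fr2 isT.
apply: wp_seq; apply: (wp_conseq (weight_spec X2 XB nX wX e_par os2 al2 tp tt _)) => //.
  by rewrite fr2.
move=> s3 bs3 fr3 s3W.
have os3 : ordered s3 by apply: ordered_frame os2 bs3 fr3 _.
have [[es3 _ s3c _] _ _] := os3.
apply: wp_seq; apply: (wp_conseq (init_spec X2 XB nX cX es3 s3c)) => s4 bs4 fr4 [t0 m0 tR mR].
have os4 : ordered s4 by apply: ordered_frame os3 bs4 fr4 _.
have al4 : alive s4 st.1 by apply: (alive_frame _ fr4 isT); apply: (alive_frame _ fr3 isT).
have s4W : s4 13 0 = weight w (desc st.1 t) by rewrite fr4.
apply: wp_seq; apply: (wp_conseq (dp_spec os4 al4 tt tmax s4W t0 m0 tR mR)) => s5 bs5 fr5 [snd opt ra].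
have os5 : ordered s5 by apply: ordered_frame os4 bs5 fr5 _.
have fr15 a j : a \notin writes p_tops ++ writes p_weight ++ writes p_init ++ writes p_dp ->
    s5 a j = s1 a j.
  rewrite mem_cat negb_or => /andP[w2]; rewrite mem_cat negb_or => /andP[w3].
  rewrite mem_cat negb_or => /andP[w4 w5].
  by rewrite (fr5 a j w5) (fr4 a j w4) (fr3 a j w3) (fr2 a j w2).
have ist5 : in_state s5 st.
  case: ist1 => -[a0 a1] o1; split; first by split=> [|v]; rewrite fr15.
  by move=> v; rewrite fr15.
have s5W : s5 13 0 = weight w (desc st.1 t) by rewrite fr5.
have s5t : s5 14 0 = t.+1 by rewrite fr15.
pose S := [set x | (x \in msk s5 t (s5 12 R.-1)) || (s5 13 0 == 0) && (x == t)].
have RmR : R.-1 < R by rewrite /R.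
have [r rE ur] : exists2 r : seq 'I_n, r =i S & uniq r.
  by exists (enum S); [apply: mem_enum | apply: enum_uniq].
(* Stated for every enumeration of [S]: one gives [S \subset st.1], which [select_spec] requires,
   and another is the order in which the program queries [S]. *)
have ph (q : seq 'I_n) : uniq q -> q =i S ->
    phase_ok e c w K st.1 (desc st.1 t, q) /\ q != [::].
  move=> uq qE; apply: (phase_knapsack rk_par e_par _ _ K1 tt _ snd opt uq) => //.
  - by rewrite card_ord.
  - by apply: ltnW; apply: rk_lt.
  - by move=> x; rewrite qE inE ra // s5W.
have SA : S \subset st.1.
  have [ok _] := ph r ur rE; apply/subsetP => x; rewrite -rE; exact: (phase_sub ok).
apply: (wp_conseq (select_spec os5 ist5 SA s5t _ _)) => //.
- by rewrite ra // best_row_le.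
- by move=> x; rewrite inE.
move=> s6 bs6 fr6 [q [uq qE ist6]]; right.
by exists (desc st.1 t, q); have [ok q0] := ph q uq qE.
Qed.

Lemma main_spec s : ordered s -> alive s [set: 'I_n] -> out s [ffun=> None] ->
  wp p_main (fun s' => exists h, [/\ phases e c w K setT h, queried h =i [set: 'I_n] &
    out s' (elim e (setT, [ffun=> None]) (queried h)).2]) s.
Proof.
move=> os al ot; have es := ordered_env os.
set st0 : {set 'I_n} * rooted_tree 'I_n := (setT, [ffun=> None]).
apply: (wp_for X2 XB (I := fun k s1 => exists h, [/\ phases e c w K setT h,
   in_state s1 (elim e st0 (queried h)) & #|(elim e st0 (queried h)).1| <= n - k])) => //.
- exists [::]; split=> //=; last by rewrite cardsT card_ord subn0.
- move=> k s1 kn es1 s1k fr [h [ph ist le]]; have [bs1 _ _] := es1.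
  have os1 : ordered s1 by apply: ordered_frame os bs1 fr _.
  apply: (wp_conseq (phase_spec os1 ist)) => s2 bs2 fr2 [[st_0 ist2]|[p [ok p0 ist2]]].
    by exists h; split=> //; rewrite st_0 cards0.
  have qE : elim e st0 (queried (rcons h p)) = elim e (elim e st0 (queried h)) p.2.
    by rewrite /queried map_rcons flatten_rcons /elim foldl_cat.
  exists (rcons h p); rewrite qE; split=> //.
    by apply: phases_rcons => //; move: ok; rewrite elim_rest.
  rewrite elim_rest; have [y yp] : exists y, y \in p.2.
    by case: (p.2) p0 => // y q _; exists y; rewrite mem_head.
  have yA := phase_sub ok yp; rewrite (cardsD1 y) yA in le.
  apply: (@leq_trans #|(elim e st0 (queried h)).1 :\ y|); last by move: le; lia.
  by apply: subset_leq_card; apply: setDS; rewrite sub1set inE.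
- move=> s1 _ _ [h [ph [_ o1] le]]; exists h; split=> // x.
  move: le; rewrite subnn leqn0 cards_eq0 elim_rest => /eqP/setP/(_ x).
  by rewrite !inE andbT => /negbFE.
Qed.

End Verification.

(** * Running time and conclusion *)

(** The 25 is the sum of the loop constants 14 and 11 of [ptime], as every loop runs at least
    once. *)
Fixpoint pcoef (p : prog) : nat :=
  match p with
  | PSkip => 1
  | PWrite _ x y => (expr_time x + expr_time y).+1
  | PSeq p q => pcoef p + pcoef q
  | PIf x p q => (expr_time x).+1 + (pcoef p + pcoef q)
  | PFor _ _ p => pcoef p + 25
  end.

(* A sufficient condition for [p] to run in time O(n ^ k * R ^ d); as n <= R, loops of
   length n may be counted as loops of length R. *)
Fixpoint form k d (p : prog) : bool :=
  match p with
  | PSkip | PWrite _ _ _ => true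
  | PSeq p q | PIf _ p q => form k d p && form k d q
  | PFor _ b p => (if k is k'.+1 then ~~ b && form k' d p else false) ||
                  (if d is d'.+1 then form k d' p else false)
  end.

Lemma form_time n R k d p : 0 < n -> n <= R -> form k d p ->
  ptime n R p <= pcoef p * (n ^ k * R ^ d).
Proof.
move=> n0 nR; have R0 : 0 < R by apply: leq_trans nR.
elim: p k d => [a x y|p IHp q IHq|x p IHp q IHq||i b p IHp] k d /=.
- by move=> _; rewrite leq_pmulr // muln_gt0 !expn_gt0 n0 R0.
- by move=> /andP[/IHp hp /IHq hq]; rewrite mulnDl leq_add.
- move=> /andP[/IHp hp /IHq hq]; rewrite !mulnDl leq_add ?leq_add //.
  by rewrite leq_pmulr // muln_gt0 !expn_gt0 n0 R0.
- by move=> _; rewrite mul1n muln_gt0 !expn_gt0 n0 R0.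
have loop N Z k' d' : 0 < N -> N <= Z -> form k' d' p ->
    N * (ptime n R p + 14) + 11 <= (pcoef p + 25) * (Z * (n ^ k' * R ^ d')).
  move=> N0 NZ /IHp; have : 0 < n ^ k' * R ^ d' by rewrite muln_gt0 !expn_gt0 n0 R0.
  move: (n ^ k' * R ^ d') => Y Y0 le.
  apply: (@leq_trans (Z * ((pcoef p + 25) * Y))); last by rewrite mulnCA.
  have : N * (ptime n R p + 14) <= Z * (pcoef p * Y + 14) by rewrite leq_mul // leq_add2r.
  nia.
case/orP.
  case: k => // k /andP[/negbTE -> fm].
  by have := loop n n k d n0 (leqnn n) fm; rewrite expnS -mulnA.
case: d => // d fm; have bR : 0 < (if b then R else n) <= R by case: (b); rewrite ?R0 ?n0 ?leqnn.
have /andP[b0 bR'] := bR.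
by have := loop _ R k d b0 bR' fm; rewrite expnS [n ^ k * (R * _)]mulnCA.
Qed.

Definition p_body := p_alive ;; p_elim ;; p_alive ;; p_main.

(** The first write stays outside [prog]: [env] presupposes that R is in place, and the static
    exponent K - 1 of the constant K depends on eps. *)
Definition solver K :=
  Seq (Write 5 (Const 0) (add (mul (get 0) (Const K)) (Const 1))) (compile p_body).

Section Correctness.
Variables (n K X B : nat) (e : rel 'I_n) (c w : 'I_n -> nat).
Let R := (n * K).+1.
Hypotheses (X2 : 2 <= X) (XB : X ^ kexp <= B) (nX : n <= X) (K1 : 1 < K) (RX : R <= X ^ 5).
Hypotheses (cX : forall v, c v <= X) (wX : forall v, w v <= X).
Hypothesis e_tree : is_tree e.

Lemma array_ofE (f : 'I_n -> nat) (v : 'I_n) : array_of f v = f v.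
Proof. by rewrite /array_of valK. Qed.

Lemma array_of_le (f : 'I_n -> nat) m i : (forall v, f v <= m) -> array_of f i <= m.
Proof. by rewrite /array_of; case: insub. Qed.

Lemma solver_spec : exists D t s,
  [/\ exec B (solver K) (input e c w) t s,
      t <= 20 + pcoef p_body * (n ^ 2 * R ^ 2),
      outputs s D,
      decision_tree e D &
      forall D', decision_tree e D' -> K.-1 * cost c w D <= 4 * K * cost c w D'].
Proof.
have [[e_sym e_irr V0 e_conn] _] := e_tree.
have n0 : 0 < n by rewrite -[n]card_ord.
set s0 := update (input e c w) 5 0 R.
have bs0 : bounded X dexp s0.
  apply: bounded_update => //; case=> [|[|[|[|a]]]] j //=.
  - by case: (j == 0); rewrite ?expn1.
  - rewrite expn0; apply: array_of_le => u; apply: array_of_le => v; exact: leq_b1.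
  - rewrite expn1; exact: array_of_le.
  - rewrite expn1; exact: array_of_le.
have is0 : inp R X e c w s0.
  split.
  - by split.
  - move=> u v; rewrite /s0 /update /= divnMDl // divn_small // addn0 array_ofE.
    by rewrite modnMDl modn_small // array_ofE.
  - by move=> v; rewrite /s0 /update /= array_ofE.
  - by move=> v; rewrite /s0 /update /= array_ofE.
have es0 : env n R X dexp s0 by case: is0.
suff [t [s [ex tle _ _ [D [oD dt apx]]]]] : wp n R X B dexp p_body (fun s => exists D,
   [/\ outputs s D, decision_tree e D &
      forall D', decision_tree e D' -> K.-1 * cost c w D <= 4 * K * cost c w D']) s0.
  have RB : R <= B by apply: leq_trans RX (leq_trans (leq_pexp2l _ _) XB) => //; lia.
  exists D, (8 + t), s; split=> //.
    apply: (@ExecSeq _ _ _ _ s0 _ 8 t _ ex).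
    apply: (@ExecWrite _ _ 5 (Const 0) (add (mul (get 0) (Const K)) (Const 1)) 0 R) => //=.
    have wordE v : v <= R -> word B v = Some v by move=> vR; rewrite /word (leq_trans vR RB).
    have nnK : n <= n * K by rewrite leq_pmulr //; lia.
    have KnK : K <= n * K by rewrite leq_pmull.
    rewrite [word B n]wordE /=; last by rewrite /R; lia.
    rewrite [word B K]wordE /=; last by rewrite /R; lia.
    by rewrite [word B (n * K)]wordE //= [word B 1]wordE //= addn1 wordE.
  (* The deepest nest consists of the phases, the vertices and the two loops of [p_merge], of
     lengths n, n, R and R. The innermost loop of the leaf search counts as one of length R. *)
  have : ptime n R p_body <= pcoef p_body * (n ^ 2 * R ^ 2).
    apply: form_time => //; rewrite /R; nia.
  by move: tle => /=; lia.
have a0 : s0 6 0 = 0 by [].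
apply: wp_seq; apply: (wp_conseq (alive_spec X2 XB es0 a0)) => s1 bs1 fr1 al1.
have is1 : inp R X e c w s1 by apply: inp_frame is0 bs1 fr1 _.
apply: wp_seq; apply: (wp_conseq (elim_spec X2 XB nX e_tree is1 al1)) => s2 bs2 fr2 [l [ol sl a2]].
have is2 : inp R X e c w s2 by apply: inp_frame is1 bs2 fr2 _.
have [es2 _ _ _] := is2.
apply: wp_seq; apply: (wp_conseq (alive_spec X2 XB es2 a2)) => s3 bs3 fr3 al3.
have is3 : inp R X e c w s3 by apply: inp_frame is2 bs3 fr3 _.
have [par [rk_par e_par parE]] := order_par e_tree ol sl.
have [ul o8 _] := ol.
have os3 : ordered R X e c w l par s3.
  split=> // [x|x]; last by rewrite fr3.
  have xl : x \in l := mem_l ul sl x.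
  have lt : index x l < n by rewrite -[X in _ < X]sl index_mem.
  by rewrite fr3 // (o8 (Ordinal lt)) ?index_mem //= nth_index.
have out3 : out s3 ([ffun=> None] : rooted_tree 'I_n).
  by move=> v; rewrite ffunE fr3 // fr2 // fr1.
apply: (wp_conseq (main_spec X2 XB nX n0 K1 cX wX ul sl rk_par e_par os3 al3 out3)).
move=> s4 bs4 fr4 [h [ph hT o4]].
have [dt apx] := phases_approx e_sym e_conn V0 ph hT.
by exists (elim e (setT, [ffun=> None]) (queried h)).2.
Qed.

End Correctness.

Import Order.TTheory GRing.Theory Num.Theory.
Local Open Scope ring_scope.

Theorem theorem2 (R : realType) :
  exists C k : nat, forall eps : R, 0 < eps ->
  exists P : cmd,
    forall (n : nat) (e : rel 'I_n) (c w : 'I_n -> nat), is_tree e ->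
    forall B : nat, word_bound k c w eps B ->
    exists (D : rooted_tree 'I_n) (t : nat) (s : store),
      [/\ exec B P (input e c w) t s,
          t%:R <= C%:R * (n%:R ^+ 4 / Num.min eps 1 ^+ 2) :> R,
          outputs s D,
          decision_tree e D &
          forall opt : nat, is_OPT e c w opt ->
            (cost c w D)%:R <= (4 + eps) * opt%:R].
Proof.
(* 400 = 4 * 100, from (n K + 1)^2 <= 4 (n K)^2 and K^2 <= 100 / min(eps, 1)^2. *)
exists ((20 + pcoef p_body) * 400)%N, kexp => eps eps0.
(* [K] satisfies 4 * K / (K - 1) <= 4 + eps and K <= 10 / min(eps, 1). *)
pose m := Num.trunc eps^-1; pose K := (4 * m + 6)%N.
have /andP[m_le lt_m] : m%:R <= eps^-1 < m.+1%:R.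
  by apply: truncn_itv; rewrite invr_ge0 ltW.
exists (solver K) => n e c w e_tree B wB.
have [[_ _ V0 _] _] := e_tree.
have n0 : (0 < n)%N by rewrite -[n]card_ord.
(* [X] is a natural number not exceeding the base of [word_bound], yet it bounds n and all input
   numbers, and 4 [X] bounds K. *)
pose M := (\max_(v < n) maxn (c v) (w v))%N; pose X := (n + M + m + 2)%N.
have XB : (X ^ kexp <= B)%N.
  rewrite -(ler_nat R) natrX; apply: le_trans wB.
  by rewrite lerXn2r ?nnegrE ?addr_ge0 ?invr_ge0 ?(ltW eps0) // /X !natrD lerD ?lerD.
have cwM v : (maxn (c v) (w v) <= M)%N := leq_bigmax v.
have cX v : (c v <= X)%N by rewrite /X; have := cwM v; lia.
have wX v : (w v <= X)%N by rewrite /X; have := cwM v; lia.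
have nX : (n <= X)%N by rewrite /X; lia.
have X2 : (2 <= X)%N by rewrite /X; lia.
have K1 : (1 < K)%N by rewrite /K; lia.
have RX : ((n * K).+1 <= X ^ 5)%N.
  have KX : (K <= 4 * X)%N by rewrite /K /X; lia.
  have nKX : (n * K <= X * (4 * X))%N by apply: leq_mul.
  have X3 : (2 ^ 3 <= X ^ 3)%N by rewrite leq_exp2r.
  have -> : (X ^ 5 = X * X * X ^ 3)%N by rewrite !expnS; lia.
  nia.
have [D [t [s [ex tle oD dt apx]]]] := solver_spec X2 XB nX K1 RX cX wX e_tree.
exists D, t, s; split=> //; last first.
  move=> opt [[D' dt' <-] _]; have := apx D' dt'.
  rewrite -(ler_nat R) !natrM => le.
  have K10 : 0 < K.-1%:R :> R by rewrite ltr0n; lia.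
  rewrite -(ler_pM2l K10); apply: le_trans le _; rewrite mulrA ler_wpM2r ?ler0n //.
  (* The claim reduces to 4 <= (K - 1) eps, which holds since K - 1 > 4 (m + 1) and m + 1 > 1 /
     eps. *)
  have -> : K%:R = K.-1%:R + 1 :> R by rewrite natr1 prednK //; lia.
  rewrite mulrDr mulr1 mulrDr [K.-1%:R * 4]mulrC lerD2l.
  have -> : K.-1%:R = 4 * m.+1%:R + 1 :> R.
    by rewrite (_ : K.-1 = (4 * m.+1 + 1)%N) ?natrD ?natrM //; rewrite /K; lia.
  have : 1 <= m.+1%:R * eps by rewrite -ler_pdivrMr // mul1r ltW.
  by move: (m.+1%:R) => y; lra.
set mn := Num.min eps 1.
have mn0 : 0 < mn by rewrite lt_min eps0 ltr01.
have mn1 : mn <= 1 by rewrite ge_min lexx orbT.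
have imn : eps^-1 <= mn^-1 by rewrite lef_pV2 ?posrE // ge_min lexx.
have imn1 : 1 <= mn^-1 by rewrite invf_ge1.
have KR : K%:R <= 10 * mn^-1 :> R.
  by rewrite /K natrD natrM; lra.
have tK : (t <= (20 + pcoef p_body) * (4 * (n ^ 4 * K ^ 2)))%N.
  apply: leq_trans tle _; rewrite mulnDl leq_add //.
    have : (0 < n ^ 4 * K ^ 2)%N by rewrite muln_gt0 !expn_gt0 n0 (ltnW K1).
    by move: (n ^ 4 * K ^ 2)%N => Z; lia.
  rewrite leq_mul2l; apply/orP; right.
  have nK : (0 < n * K)%N by rewrite muln_gt0 n0 (ltnW K1).
  have : ((n * K).+1 ^ 2 <= (2 * (n * K)) ^ 2)%N by rewrite leq_exp2r //; lia.
  rewrite -(leq_pmul2l (_ : 0 < n ^ 2)%N) ?expn_gt0 ?n0 // => /leq_trans; apply.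
  by rewrite !expnMn !expnS; lia.
move: tK; rewrite -(ler_nat R) => /le_trans; apply.
rewrite natrM [((20 + _) * 400)%:R]natrM -[leRHS]mulrA ler_wpM2l ?ler0n //.
rewrite natrM [(n ^ 4 * _)%:R]natrM !natrX -exprVn mulrCA [400 * _]mulrCA ler_wpM2l ?exprn_ge0 ?ler0n //.
have : K%:R ^+ 2 <= (10 * mn^-1) ^+ 2 :> R by rewrite lerXn2r ?nnegrE ?mulr_ge0 ?invr_ge0 ?(ltW mn0).
by rewrite exprMn; lra.
Qed.
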